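(* Let $V$ be a finite set with $|V|=n$. Suppose $\alpha=\sum_{\ell=2}^n w_\ell\,\alpha^\ell$ for some nonnegative vector $w=(w_2,\dots,w_n)$, where $\alpha^\ell$ denotes the collection of weights $\alpha^\ell_A=\mathbf 1_{|A|=\ell}$, $A\subset V$. Then $$\kappa[\alpha,\mathcal S_n]=\sum_{\ell=2}^n w_\ell\,\frac{\binom n\ell\log \ell!}{\log n!},$$ and equality in the inequality $$\kappa\,\mathrm{Ent} f\le\sum_{A\subset V}\alpha_A\,\mu[\mathrm{Ent}_A f]$$ (with $\kappa=\kappa[\alpha,\mathcal S_n]$) is uniquely achieved at multiples of a Dirac mass.
   Context: $\mathcal S_n$ is the set of the $n!$ permutations, viewed as vectors $\sigma=(\sigma_x)_{x\in V}$ assigning to the vertices of $V$ the distinct labels $1,\dots,n$ ($\sigma_x=i$ means that the particle with label $i$ is at vertex $x$), and $\mu$ is the uniform distribution on $\mathcal S_n$. For $A\subset V$ and $f:\mathcal S_n\to\mathbb R$, $\mu_A f=\mu[f\mid\sigma_z,\ z\notin A]$ is the conditional expectation given the labels at all vertices outside $A$. For $f\ge0$, $\mathrm{Ent}_A f=\mu_A[f\log(f/\mu_A f)]$ (with $0\log0=0$) and $\mathrm{Ent} f=\mathrm{Ent}_V f$. For a collection of nonnegative weights $\alpha=\{\alpha_A,\ A\subset V\}$, the entropy constant $\kappa[\alpha,\mathcal S_n]$ is the largest $\kappa\ge0$ such that $\kappa\,\mathrm{Ent} f\le\sum_{A\subset V}\alpha_A\,\mu[\mathrm{Ent}_A f]$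 for all $f:\mathcal S_n\to[0,\infty)$. A Dirac mass is a function of the form $f(\sigma)=\mathbf 1_{\sigma=\sigma_0}$ for a fixed $\sigma_0\in\mathcal S_n$.
   Formalization: Assumes n ≥ 2 (else κ is undefined); uniqueness of equality is claimed only for non-constant f and when some w_ℓ > 0 with 2 ≤ ℓ < n, since constant f always give equality and if only w_n can be nonzero every f does. *)

(* Defs.v *)
From mathcomp Require Import all_boot all_order all_algebra.
From mathcomp Require Import all_classical all_reals all_analysis.

Set Implicit Arguments.
Unset Strict Implicit.
Unset Printing Implicit Defensive.

Import Order.TTheory GRing.Theory Num.Theory.
Local Open Scope ring_scope.

(* The set S_n, for n = #|V|: injective assignments of labels to vertices, with
   the labels 1, ..., n encoded as the elements 0, ..., n-1 of 'I_n.
   [val s x = i] means that the particle with label i is at vertex x. *)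
Definition labelling (V : finType) : Type :=
  {s : {ffun V -> 'I_#|V|} | injectiveb s}.

Definition agree_off (V : finType) (A : {set V}) (s t : labelling V) : bool :=
  [forall z, (z \notin A) ==> (val t z == val s z)].

Definition mean (R : realType) (V : finType) (f : labelling V -> R) : R :=
  (\sum_(s : labelling V) f s) / #|{: labelling V}|%:R.

(* mu_A f = mu[f | s_z, z \notin A], as a function of s: the average of f over
   the configurations having the same labels as s outside A. *)
Definition cond_mean (R : realType) (V : finType) (A : {set V})
    (f : labelling V -> R) (s : labelling V) : R :=
  (\sum_(t : labelling V | agree_off A s t) f t)
    / #|[pred t : labelling V | agree_off A s t]|%:R.

(* No convention is needed for 0 log 0: the factor f t vanishes there, and if
   cond_mean A f t = 0 with f >= 0 then f t = 0 as well. *)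
Definition cond_ent (R : realType) (V : finType) (A : {set V})
    (f : labelling V -> R) : labelling V -> R :=
  cond_mean A (fun t => f t * ln (f t / cond_mean A f t)).

(* Ent_V f is a constant function on S_n (see cond_ent_setT); ent f is its
   value. *)
Definition ent (R : realType) (V : finType) (f : labelling V -> R) : R :=
  mean (fun t => f t * ln (f t / mean f)).

Lemma agree_off_setT (V : finType) (s t : labelling V) :
  agree_off [set: V] s t.
Proof. by apply/forallP => z; rewrite inE. Qed.

Lemma cond_mean_setT (R : realType) (V : finType) (f : labelling V -> R)
    (s : labelling V) : cond_mean [set: V] f s = mean f.
Proof.
rewrite /cond_mean /mean; congr (_ / _%:R).
  by apply: eq_bigl => t; rewrite agree_off_setT.
by apply: eq_card => t; rewrite !inE agree_off_setT.
Qed.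

Lemma cond_ent_setT (R : realType) (V : finType) (f : labelling V -> R)
    (s : labelling V) : cond_ent [set: V] f s = ent f.
Proof.
rewrite /cond_ent cond_mean_setT /ent /mean; congr (_ / _).
by apply: eq_bigr => t _; rewrite cond_mean_setT.
Qed.

Definition total_ent (R : realType) (V : finType) (alpha : {set V} -> R)
    (f : labelling V -> R) : R :=
  \sum_(A : {set V}) alpha A * mean (cond_ent A f).

Definition admissible (R : realType) (V : finType) (alpha : {set V} -> R)
    (k : R) : Prop :=
  0 <= k /\
  forall f : labelling V -> R, (forall s, 0 <= f s) ->
    k * ent f <= total_ent alpha f.

(* The supremum of the admissible constants; it is the largest admissible
   constant as soon as the set of those is bounded above, i.e. for #|V| >= 2. *)
Definition entropy_constant (R : realType) (V : finType)
    (alpha : {set V} -> R) : R :=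
  sup [set k : R | admissible alpha k]%classic.

Definition dirac (R : realType) (V : finType) (s0 : labelling V) :
    labelling V -> R :=
  fun s => (s == s0)%:R.

Definition dirac_multiple (R : realType) (V : finType)
    (f : labelling V -> R) : Prop :=
  exists (c : R) (s0 : labelling V), forall s, f s = c * dirac R s0 s.

Definition layer (R : realType) (V : finType) (l : nat) (A : {set V}) : R :=
  (#|A| == l)%:R.

(* Main.v *)
(* Write S_A(s) for the sum of f over the configurations agreeing with s off A,
   K(A) = sum_s f(s) log S_A(s), and t_l for the average of K(A) over |A| = l.
   Up to normalization the mean of Ent_A f over |A| = l is
   t_0 - t_l + (log l!) sum f, so the claim is that (t_l - t_0) / log l! is at
   most its value at l = n. As t_1 = t_0, this follows once
   (t_l - t_(l-1)) / log l is nondecreasing in l.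

   Fix A with m = |A| and the labels off A; let Z be the mass of the class and
   a_x(j) the mass of { s_x = j }. By Gibbs' inequality, replacing the law of
   s_x given s_y = j by the law of s_x given s_x <> j bounds the
   two-step increments of K by a sum over labels j involving only the
   column a(j). What remains is, for a nonnegative vector a of length m >= 3
   and sum Z,
     sum (Z - a_x) log (Z / (Z - a_x)) >= c sum a_x log (Z / a_x),
   c = (m - 1) log (m / (m - 1)) / log m, with equality only at Dirac and
   uniform vectors. The difference is a sum of values of a function psi which is
   convex, then concave; merging coordinates reduces to vectors
   (b, ..., b, 1 - (m-1) b), a one-variable inequality.

   In the equality case all columns at A = V are Dirac or uniform; all are Dirac
   (and f is a multiple of a Dirac mass) or all uniform, which forces
   Ent f = 0. *)

Require Import Defs.
From mathcomp Require Import all_boot all_order all_algebra.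
From mathcomp Require Import all_classical all_reals all_analysis.
From mathcomp Require Import perm ring lra zify.

Set Implicit Arguments.
Unset Strict Implicit.
Unset Printing Implicit Defensive.

Import Order.TTheory GRing.Theory Num.Theory.
Local Open Scope ring_scope.

(** * The column inequality *)

Section Analysis.
Variable R : realType.
Implicit Types (a b c t u v x y z : R) (f df : R -> R).

Lemma lt_of_derive_gt0 f df a b : a < b ->
  (forall x, a <= x <= b -> is_derive x 1 f (df x)) ->
  (forall x, a < x < b -> 0 < df x) -> f a < f b.
Proof.
move=> ab fd df0.
have [||d] := @MVT R f df a b ab.
- by move=> x; rewrite in_itv/= => /andP[ax xb]; apply: fd; rewrite !ltW.
- apply: derivable_within_continuous => x; rewrite in_itv/= => xab.
  by have [] := fd x xab.
rewrite in_itv/= => dab e.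
by rewrite -subr_gt0 e mulr_gt0 ?df0 ?subr_gt0.
Qed.

Lemma is_derive_ln_comp f x d : is_derive x 1 f d -> 0 < f x ->
  is_derive x 1 (fun y => ln (f y)) (d / f x).
Proof.
move=> fd f0.
have lnd := is_derive1_ln f0.
apply: is_derive_eq.
by rewrite mulrC.
Qed.

Lemma ln_lt_sub1 x : 0 < x -> x != 1 -> ln x < x - 1.
Proof.
move=> x0 x1; have := @expR_gt1Dx R (ln x); rewrite lnK ?posrE//.
by rewrite ln_eq0// => /(_ x1); lra.
Qed.

Lemma ln_le_sub1 x : 0 < x -> ln x <= x - 1.
Proof.
by move=> x0; have := @expR_ge1Dx R (ln x); rewrite lnK ?posrE//; lra.
Qed.

Lemma lnB_lt x y : 0 < x -> 0 < y -> x != y -> ln x - ln y < (x - y) / y.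
Proof.
move=> x0 y0 xy; rewrite -ln_div ?posrE//.
have -> : (x - y) / y = x / y - 1 by field; rewrite gt_eqF.
apply: ln_lt_sub1; first by rewrite divr_gt0.
by apply: contra xy => /eqP e; rewrite -(divfK (lt0r_neq0 y0) x) e mul1r.
Qed.


(* [psi c] is convex on [0, c / (1 + c)] and concave on [c / (1 + c), 1];
   hypotheses of the form [t * (1 + c) <= c] place [t] in the convex range. *)
Definition psi c t := c * (t * ln t) - (1 - t) * ln (1 - t).

Definition dpsi c t := c * (ln t + 1) + ln (1 - t) + 1.

Lemma psi0 c : psi c 0 = 0.
Proof. by rewrite /psi ln0// subr0 ln1 !mulr0 subr0. Qed.

Lemma psi1 c : psi c 1 = 0.
Proof. by rewrite /psi ln1 subrr ln0// !mulr0 subr0. Qed.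

Lemma is_derive_xlnx_comp f x d : is_derive x 1 f d -> 0 < f x ->
  is_derive x 1 (fun y => f y * ln (f y)) (d * (ln (f x) + 1)).
Proof.
move=> fd f0.
have lnd := is_derive_ln_comp fd f0.
apply: is_derive_eq.
rewrite /GRing.scale/=; field.
by rewrite gt_eqF.
Qed.

Lemma is_derive_affine p q x : is_derive x 1 (fun y => p + q * y) q.
Proof.
apply: is_derive_eq.
by rewrite /GRing.scale/=; ring.
Qed.

Lemma is_derive_psi_comp c p q x : 0 < p + q * x < 1 ->
  is_derive x 1 (fun y => psi c (p + q * y)) (q * dpsi c (p + q * x)).
Proof.
move=> /andP[t0 t1].
have d1 := is_derive_xlnx_comp (is_derive_affine p q x) t0.
have aff : is_derive x 1 (fun y => 1 - (p + q * y)) (- q).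
  apply: is_derive_eq.
  by rewrite /GRing.scale/=; ring.
have d2 := is_derive_xlnx_comp aff _.
have {}d2 := d2 ltac:(by rewrite subr_gt0).
apply: is_derive_eq.
rewrite /GRing.scale/= /dpsi; ring.
Qed.

(** Bounding both logarithms by their tangents at the endpoint [u] leaves a rational expression with
    the sign of [u * (1 + c) - c]; this avoids second derivatives. *)
Lemma dpsi_increasing c t u : 0 < t -> t < u -> u * (1 + c) <= c -> u < 1 ->
  dpsi c t < dpsi c u.
Proof.
move=> t0 tu uc u1.
have u0 : 0 < u by lra.
have c0 : 0 < c by nra.
have h1 : ln t - ln u < (t - u) / u by apply: lnB_lt; rewrite // lt_eqF.
have h2 : ln (1 - t) - ln (1 - u) < (1 - t - (1 - u)) / (1 - u).
  by apply: lnB_lt; rewrite ?gt_eqF//; lra.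
have h3 : c * ((t - u) / u) + (1 - t - (1 - u)) / (1 - u) <= 0.
  have -> : c * ((t - u) / u) + (1 - t - (1 - u)) / (1 - u) =
    (u - t) * (u * (1 + c) - c) / (u * (1 - u)).
    by field; apply/andP; split; apply: lt0r_neq0; lra.
  by rewrite pmulr_lle0 ?invr_gt0 ?mulr_gt0//; [nra | lra].
have h4 : c * (ln t - ln u) < c * ((t - u) / u) by rewrite ltr_pM2l.
rewrite /dpsi; lra.
Qed.

Lemma dpsi_decreasing c t u : 0 < c -> 0 < t -> t < u -> c <= t * (1 + c) ->
  u < 1 -> dpsi c u < dpsi c t.
Proof.
move=> c0 t0 tu tc u1.
have h1 : ln u - ln t < (u - t) / t by apply: lnB_lt; rewrite ?gt_eqF//; lra.
have h2 : ln (1 - u) - ln (1 - t) < (1 - u - (1 - t)) / (1 - t).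
  by apply: lnB_lt; rewrite ?lt_eqF//; lra.
have h3 : c * ((u - t) / t) + (1 - u - (1 - t)) / (1 - t) <= 0.
  have -> : c * ((u - t) / t) + (1 - u - (1 - t)) / (1 - t) =
    (u - t) * (c - t * (1 + c)) / (t * (1 - t)).
    by field; apply/andP; split; apply: lt0r_neq0; lra.
  by rewrite pmulr_lle0 ?invr_gt0 ?mulr_gt0//; [nra | lra].
have h4 : c * (ln u - ln t) < c * ((u - t) / t) by rewrite ltr_pM2l.
rewrite /dpsi; lra.
Qed.

Lemma psi_tangent c z u : 0 < z -> z * (1 + c) <= c -> 0 <= u ->
  u * (1 + c) <= c -> 0 < c -> u != z ->
  psi c z + dpsi c z * (u - z) < psi c u.
Proof.
move=> z0 zc u0 uc c0 uz.
have z1 : z < 1 by nra.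
have u1 : u < 1 by nra.
(* At 0 the slope of [psi c] is infinite, so this endpoint is checked by hand: it amounts to
   [0 < (1 + c) * z + ln (1 - z)]. *)
have [->|un0] := eqVneq u 0.
  rewrite psi0 /psi /dpsi.
  have : ln 1 - ln (1 - z) < (1 - (1 - z)) / (1 - z).
    by apply: lnB_lt; rewrite ?gt_eqF//; lra.
  rewrite ln1 ltr_pdivlMr; last lra.
  have -> : 1 - (1 - z) = z by ring.
  rewrite sub0r => h.
  suff: 0 < (1 + c) * z + ln (1 - z) by lra.
  have : 0 < ((1 + c) * z + ln (1 - z)) * (1 - z) by nra.
  by rewrite pmulr_lgt0//; lra.
have {un0}u0 : 0 < u by rewrite lt0r un0.
pose h y := psi c (0 + 1 * y) - dpsi c z * (0 + 1 * y).
have hd y : 0 < y < 1 -> is_derive y 1 h (dpsi c y - dpsi c z).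
  move=> y01.
  have d1 := is_derive_affine 0 1 y.
  have d2 := @is_derive_psi_comp c 0 1 y.
  rewrite !add0r !mul1r in d2; have {}d2 := d2 y01.
  apply: is_derive_eq.
  by rewrite /GRing.scale/=; ring.
suff: h z < h u by rewrite /h !add0r !mul1r; lra.
case: (ltgtP u z) uz => // [uz|zu] _.
- have := @lt_of_derive_gt0 (fun y => - h y) (fun y => - (dpsi c y - dpsi c z)) u z uz.
  rewrite ltrN2; apply => y /andP[uy yz].
  + have d := hd y ltac:(lra).
    by apply: is_derive_eq.
  + by rewrite oppr_gt0 subr_lt0; apply: dpsi_increasing => //; lra.
- apply: (@lt_of_derive_gt0 h (fun y => dpsi c y - dpsi c z) _ _ zu) => y.
    by move=> /andP[uy yz]; apply: hd; lra.
  move=> /andP[uy yz].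
  by rewrite subr_gt0; apply: dpsi_increasing => //; nra.
Qed.

Lemma psi_jensen c (k : nat) t u : 0 < c ->
  0 <= t -> t * (1 + c) <= c -> 0 <= u -> u * (1 + c) <= c ->
  (0 < k)%N -> t != u ->
  k.+1%:R * psi c ((k%:R * t + u) / k.+1%:R) < k%:R * psi c t + psi c u.
Proof.
move=> c0 t0 tc u0 uc k0 tu.
set z := _ / _.
have k0' : 0 < k%:R :> R by rewrite ltr0n.
have zE : (k%:R + 1) * z = k%:R * t + u.
  by rewrite /z -natr1; field; rewrite natr1.
have z0 : 0 < z.
  have : 0 < (k%:R + 1) * z.
    rewrite zE; case: (ltgtP t u) tu => // h _; nra.
  by rewrite pmulr_rgt0//; lra.
have zc : z * (1 + c) <= c.
  rewrite -(@ler_pM2l _ (k%:R + 1)); last lra.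
  by rewrite mulrA zE; nra.
have tz : t != z.
  by apply: contra tu => /eqP e; apply/eqP; nra.
have uz : u != z.
  apply: contra tu => /eqP e; apply/eqP; rewrite -e in zE.
  by apply: (mulfI (lt0r_neq0 k0')); lra.
have h1 := psi_tangent z0 zc t0 tc c0 tz.
have h2 := psi_tangent z0 zc u0 uc c0 uz.
have h3 : k%:R * (psi c z + dpsi c z * (t - z)) < k%:R * psi c t by rewrite ltr_pM2l.
rewrite -natr1.
have : dpsi c z * ((k%:R + 1) * z) = dpsi c z * (k%:R * t + u) by rewrite zE.
by lra.
Qed.

(** By concavity, the increment of [psi c] over a window of length [v - p] decreases as the window
    moves right, so pushing [u] down to [p] and [v] up by as much lowers the sum. *)
Lemma psi_merge c p u v : 0 < c -> 0 < p -> c <= p * (1 + c) ->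
  p < u -> p < v -> u + v <= 1 ->
  psi c p + psi c (u + v - p) < psi c u + psi c v.
Proof.
move=> c0 p0 pc pu pv uv.
pose h y := psi c (0 + 1 * y) - psi c ((v - p) + 1 * y).
have hd y : p <= y <= u ->
    is_derive y 1 h (dpsi c y - dpsi c (v - p + y)).
  move=> /andP[py yu].
  have d1 := @is_derive_psi_comp c 0 1 y ltac:(lra).
  have d2 := @is_derive_psi_comp c (v - p) 1 y ltac:(lra).
  apply: is_derive_eq.
  by rewrite !add0r !mul1r.
suff: h p < h u.
  rewrite /h !add0r !mul1r subrK.
  have -> : v - p + u = u + v - p by ring.
  lra.
apply: (lt_of_derive_gt0 pu hd) => y /andP[py yu].
by rewrite subr_gt0; apply: dpsi_decreasing => //; nra.
Qed.


(** By strict Jensen, equality forces [k = 0] or [b = w]; hence the last clause can be an equality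
    of sequences, which the induction below turns into a permutation. *)
Lemma psi_average c (k : nat) b w : 0 < c ->
  0 <= b -> b * (1 + c) <= c -> 0 <= w -> w * (1 + c) <= c ->
  exists z, [/\ 0 <= z, z * (1 + c) <= c, k.+1%:R * z = k%:R * b + w,
    k.+1%:R * psi c z <= k%:R * psi c b + psi c w &
    k.+1%:R * psi c z = k%:R * psi c b + psi c w ->
      nseq k.+1 z = w :: nseq k b].
Proof.
move=> c0 b0 bc w0 wc.
case: k => [|k]; first by exists w; split=> //; rewrite !mul0r !add0r !mul1r.
have nE : k.+2%:R = k.+1%:R + 1 :> R by rewrite natr1.
have [<-|bw] := eqVneq b w.
  by exists b; split=> //; rewrite nE; lra.
have n0 : k.+2%:R != 0 :> R by rewrite pnatr_eq0.
have n0' : 0 < k.+2%:R :> R by rewrite ltr0n.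
have n1 : 0 < k.+1%:R :> R by rewrite ltr0n.
have J := @psi_jensen c k.+1 b w c0 b0 bc w0 wc isT bw.
exists ((k.+1%:R * b + w) / k.+2%:R); split.
- by apply: divr_ge0; [apply: addr_ge0 => //; apply: mulr_ge0|].
- by rewrite mulrAC ler_pdivrMr// nE; nra.
- by rewrite mulrC divfK.
- exact: ltW.
- by move=> e; rewrite e ltxx in J.
Qed.

(* Convex-concave rearrangement: a sum of values of [psi c] over a point of
   the simplex only decreases if the coordinates in the concave range are
   merged into one and those in the convex range are averaged. *)
Lemma psi_rearrange c u (s : seq R) : 0 < c ->
  all (fun x => 0 <= x) (u :: s) -> \sum_(x <- u :: s) x <= 1 ->
  exists b v, [/\ 0 <= b, b * (1 + c) <= c, b = v \/ c <= v * (1 + c) &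
   [/\ (size s)%:R * b + v = \sum_(x <- u :: s) x,
    (size s)%:R * psi c b + psi c v <= \sum_(x <- u :: s) psi c x &
    (size s)%:R * psi c b + psi c v = \sum_(x <- u :: s) psi c x ->
      perm_eq (u :: s) (v :: nseq (size s) b)]].
Proof.
move=> c0; elim: s => [|w s IH] in u * => s0 s1.
  rewrite !big_seq1 in s1 *; move: s0; rewrite /= andbT => u0.
  have [uc|/ltW uc] := leP (u * (1 + c)) c; [exists u, u | exists 0, u].
    by split=> //; [left | rewrite !mul0r !add0r].
  by split=> //; [lra | right | rewrite !mul0r !add0r].
have /andP[w0 s0'] : (0 <= w) && all (fun x => 0 <= x) (u :: s).
  by move: s0 => /= /and3P[-> -> ->].
have S F : \sum_(x <- [:: u, w & s]) F x = F w + \sum_(x <- u :: s) F x :> R.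
  by rewrite !big_cons addrCA.
rewrite !S in s1 *.
have [b [v [b0 bc bv [sE sle sq]]]] := IH u s0' ltac:(lra).
have P (l : seq R) : perm_eq (u :: s) l -> perm_eq [:: u, w & s] (w :: l).
  move=> ul; apply: perm_trans (_ : perm_eq [:: w, u & s] _).
    by rewrite -[X in perm_eq X _]/([:: u; w] ++ s)
      -[X in perm_eq _ X]/([:: w; u] ++ s)
      perm_cat2r (perm_catC [:: u] [:: w]).
  by rewrite perm_cons.
set k := size s in sE sle sq *; rewrite [size _]/=.
have kE : k.+1%:R = k%:R + 1 :> R by rewrite natr1.
have kb : 0 <= k%:R * b by rewrite mulr_ge0.
(* A convex [w] is averaged with the copies of [b]; a concave [w] becomes the exceptional value if
   [v = b], and is otherwise merged with [v]. *)
have [wc|wc] := leP (w * (1 + c)) c; case: bv => bv.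
- rewrite -{}bv in sE sle sq *.
  have [z [z0 zc zE zle zeq]] := @psi_average c k.+1 b w c0 b0 bc w0 wc.
  rewrite -(natr1 k.+1) kE in zE zle zeq.
  exists z, z; split=> //; first by left.
  rewrite kE; split; [lra|lra|] => e.
  have := zeq ltac:(lra); rewrite [nseq k.+2 z]/= => ->.
  by apply: P; apply: sq; lra.
- have [z [z0 zc zE zle zeq]] := @psi_average c k b w c0 b0 bc w0 wc.
  rewrite kE in zE zle zeq.
  exists z, v; split=> //; first by right.
  rewrite kE; split; [lra|lra|] => e.
  rewrite zeq; last lra.
  apply: perm_trans (P _ (sq _)) _; first lra.
  by rewrite -[X in perm_eq X _]/([:: w; v] ++ nseq k b)
    -[X in perm_eq _ X]/([:: v; w] ++ nseq k b)
    perm_cat2r (perm_catC [:: w] [:: v]).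
- rewrite -{}bv in sE sle sq *.
  exists b, w; split=> //; first by right; lra.
  rewrite kE; split; [lra|lra|] => e.
  by apply: P; apply: sq; lra.
(* The inflection point belongs to both ranges: [w] and [v] are replaced by [p] and [w + v - p],
   then [p] is averaged with the copies of [b]. If [v > p] the merge is strict and the equality
   clause is vacuous. *)
- pose p := c / (1 + c).
  have pc : p * (1 + c) = c by rewrite divfK//; lra.
  have p0 : 0 < p by rewrite divr_gt0//; lra.
  have [z [z0 zc zE zle zeq]] := @psi_average c k b p c0 b0 bc (ltW p0) ltac:(lra).
  rewrite kE in zE zle zeq.
  exists z, (w + v - p); split=> //; first by right; nra.
  have pw : p < w by nra.
  have [vp|vp] := eqVneq v p.
    rewrite vp addrK in sE sle sq *.
    rewrite kE; split; [lra|lra|] => e.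
    by rewrite zeq; [apply: P; apply: sq; lra|lra].
  have pv : p < v by rewrite lt_neqAle eq_sym vp/=; nra.
  have M := @psi_merge c p w v c0 p0 ltac:(lra) pw pv ltac:(lra).
  by rewrite kE; split; lra.
Qed.


End Analysis.

(** * Vectors with all coordinates but one equal *)

Section TwoValues.
Variable R : realType.
Implicit Types (b c p q t u v x y z : R) (f df : R -> R).

Lemma is_derive_ln_affine p q x : 0 < p + q * x ->
  is_derive x 1 (fun y => ln (p + q * y)) (q / (p + q * x)).
Proof. exact: is_derive_ln_comp (is_derive_affine p q x). Qed.

(* The derivative of [k psi(y) + psi(1 - k y)] is [k g(y)], the sum itself is
   [k y g(y) + E(y)], and [g'] and [E'] are governed by the single affine
   function [N]. *)
Lemma psi_two_values_gt0 (k : nat) c b : (2 <= k)%N ->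
  c * ln k.+1%:R = k%:R * (ln k.+1%:R - ln k%:R) ->
  0 < b -> (k%:R + 1) * b < 1 ->
  0 < k%:R * psi c b + psi c (1 - k%:R * b).
Proof.
move=> k2 cE b0 b1.
set K : R := k%:R.
have K2 : 2 <= K by rewrite (ler_nat _ 2).
have mE : k.+1%:R = K + 1 :> R by rewrite natr1.
rewrite mE -/K in cE b1 *.
have lnK0 : 0 < ln K by apply: ln_gt0; lra.
have lnm0 : 0 < ln (K + 1) by apply: ln_gt0; lra.
have lnKm : ln K < ln (K + 1) by rewrite ltr_ln ?posrE; lra.
have c0 : 0 < c by rewrite -(pmulr_lgt0 _ lnm0) cE mulr_gt0; lra.
have cK : c < K by rewrite -(ltr_pM2r lnm0) cE ltr_pM2l; lra.
pose N y := (K - c) * y - (1 - c).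
pose g y := dpsi c y - dpsi c (1 + - K * y).
pose G y := K * psi c (0 + 1 * y) + psi c (1 + - K * y).
pose E y := c * ln (1 + - K * y) - K * ln (1 + -1 * y).
(* At the uniform point [m1] both [g] and, by the choice of [c], [G] vanish. *)
pose m1 : R := (K + 1)^-1.
have m1E : (K + 1) * m1 = 1 by rewrite divff//; lra.
have bm : b < m1 by nra.
have Km y : 0 < y -> y <= m1 -> 0 < 1 + - K * y /\ y < 1.
  by move=> y0 ym; split; nra.
have GE y : 0 < y -> y <= m1 -> G y = K * y * g y + E y.
  move=> y0 ym; rewrite /G /g /E /psi /dpsi !add0r !mul1r.
  have -> : 1 - (1 + - K * y) = K * y by ring.
  by rewrite mulN1r; ring.
have lnm1 : ln m1 = - ln (K + 1) by rewrite lnV ?posrE//; lra.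
have m10 : 0 < m1 by rewrite invr_gt0; lra.
have Km1 : 1 + - K * m1 = m1 by lra.
have gm : g m1 = 0 by rewrite /g Km1 subrr.
have Gm : G m1 = 0.
  rewrite GE// gm mulr0 add0r /E Km1 mulN1r.
  have -> : 1 - m1 = K * m1 by lra.
  rewrite lnM ?posrE//; last lra.
  by rewrite lnm1; lra.
have gd y : 0 < y -> y <= m1 ->
    is_derive y 1 g (N y / (y * (1 - y) * (1 + - K * y))).
  move=> y0 ym; have [h1 h2] := Km y y0 ym.
  have d1 := @is_derive_ln_affine 0 1 y ltac:(lra).
  have d2 := @is_derive_ln_affine 1 (-1) y ltac:(lra).
  have d3 := @is_derive_ln_affine 1 (- K) y h1.
  have -> : g = (fun y => c * ln (0 + 1 * y) + ln (1 + -1 * y)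
     - c * ln (1 + - K * y) - ln (1 - (1 + - K * y))).
    by apply/funext => z; rewrite /g /dpsi add0r mul1r mulN1r; ring.
  have d4 : is_derive y 1 (fun y => ln (1 - (1 + - K * y))) (K / (K * y)).
    have -> : (fun y => ln (1 - (1 + - K * y))) = (fun y => ln (0 + K * y)).
      by apply/funext => z; congr ln; ring.
    have d := @is_derive_ln_affine 0 K y ltac:(nra).
    by apply: is_derive_eq; rewrite add0r.
  apply: is_derive_eq.
  rewrite /GRing.scale/= /N; field.
  by repeat (apply/andP; split); apply: lt0r_neq0; lra.
have Gd y : 0 < y -> y <= m1 -> is_derive y 1 G (K * g y).
  move=> y0 ym; have [h1 h2] := Km y y0 ym.
  have d1 := @is_derive_psi_comp _ c 0 1 y ltac:(lra).
  have d2 := @is_derive_psi_comp _ c 1 (- K) y ltac:(nra).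
  apply: is_derive_eq.
  by rewrite /GRing.scale/= /g add0r !mul1r; ring.
have Ed y : 0 <= y -> y <= m1 ->
    is_derive y 1 E (- K * N y / ((1 - y) * (1 + - K * y))).
  move=> y0 ym; have [h1 h2] : 0 < 1 + - K * y /\ y < 1 by split; nra.
  have d2 := @is_derive_ln_affine 1 (-1) y ltac:(lra).
  have d3 := @is_derive_ln_affine 1 (- K) y h1.
  apply: is_derive_eq.
  rewrite /GRing.scale/= /N; field.
  by apply/andP; split=> //; apply: lt0r_neq0; lra.
have E0 : E 0 = 0 by rewrite /E !mulr0 addr0 ln1 !mulr0 subrr.
(* The slope [K - c] of [N] is positive, so [N] stays positive from [y] on and [g] increases up to
   its zero [m1]. *)
have gneg y : 0 < y -> y < m1 -> 0 < N y -> g y < 0.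
  move=> y0 ym Ny; rewrite -gm.
  apply: (@lt_of_derive_gt0 _ g (fun y => N y / (y * (1 - y) * (1 + - K * y))) _ _ ym).
    by move=> z /andP[yz zm]; apply: gd => //; lra.
  move=> z /andP[yz zm]; have [h1 h2] := Km z ltac:(lra) (ltW zm).
  rewrite divr_gt0//; first by rewrite /N in Ny *; nra.
  by rewrite !mulr_gt0//; lra.
have gdec y : b < y -> y < m1 -> N y <= 0 -> g y < g b.
  move=> by_ ym Ny; rewrite -ltrN2.
  apply: (@lt_of_derive_gt0 _ (fun y => - g y)
    (fun y => - (N y / (y * (1 - y) * (1 + - K * y)))) _ _ by_).
    move=> z /andP[bz zy]; have d := gd z ltac:(lra) ltac:(lra).
    exact: is_derive_eq.
  move=> z /andP[yz zm]; have [h1 h2] := Km z ltac:(lra) ltac:(lra).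
  rewrite -mulNr divr_gt0//; first by rewrite /N in Ny *; nra.
  by rewrite !mulr_gt0//; lra.
suff : 0 < G b by rewrite /G add0r mul1r mulNr.
have fromg : (forall y, b < y -> y < m1 -> g y < 0) -> 0 < G b.
  move=> gy; rewrite -oppr_lt0 -[X in _ < X]oppr0 -Gm.
  apply: (@lt_of_derive_gt0 _ (fun y => - G y) (fun y => - (K * g y)) _ _ bm).
    move=> z /andP[bz zm]; have d := Gd z ltac:(lra) zm.
    exact: is_derive_eq.
  move=> z /andP[bz zm]; rewrite oppr_gt0 pmulr_rlt0; last lra.
  exact: gy.
have [Nb|Nb] := ltP 0 (N b).
  apply: fromg => y by_ ym; apply: gneg => //; first lra.
  by rewrite /N in Nb *; nra.
(* Here [N b <= 0]: beyond [b], [g] decreases as long as [N] is nonpositive and then increases to 0,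
   so [g b < 0] keeps it negative. *)
have [gb|gb] := ltP (g b) 0.
  apply: fromg => y by_ ym; have [Ny|Ny] := ltP 0 (N y).
    by apply: gneg => //; lra.
  by apply: lt_trans (gdec y by_ ym Ny) gb.
(* In the remaining case [N b <= 0] and [g b >= 0]: [E] increases from 0 on [[0, b]], so [G b] is a
   nonnegative term plus [E b > 0]. *)
rewrite GE ?(ltW bm)//.
have : E 0 < E b.
  apply: (@lt_of_derive_gt0 _ E (fun y => - K * N y / ((1 - y) * (1 + - K * y))) _ _ b0).
    by move=> z /andP[bz zm]; apply: Ed; lra.
  move=> z /andP[bz zm]; have [h1 h2] := Km z ltac:(lra) ltac:(lra).
  rewrite divr_gt0//; last by rewrite mulr_gt0//; lra.
  have : N z < 0 by rewrite /N in Nb *; nra.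
  by nra.
rewrite E0 => Eb.
have : 0 <= K * b * g b by rewrite !mulr_ge0//; lra.
by lra.
Qed.

End TwoValues.

(** * The entropy inequality for one column *)

Section ColumnInequality.
Variable R : realType.
Implicit Types (b c u v : R).

Lemma psi_inv_card c (k : nat) : (0 < k)%N ->
  c * ln k.+1%:R = k%:R * (ln k.+1%:R - ln k%:R) -> psi c k.+1%:R^-1 = 0.
Proof.
move=> k0 cE.
have k0' : 0 < k%:R :> R by rewrite ltr0n.
have m0 : 0 < k.+1%:R :> R by rewrite ltr0n.
have mE : k.+1%:R = k%:R + 1 :> R by rewrite natr1.
rewrite /psi.
have -> : 1 - k.+1%:R^-1 = k%:R * k.+1%:R^-1 :> R.
  by rewrite mE; field; lra.
rewrite lnM ?lnV ?posrE ?invr_gt0//.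
transitivity ((k%:R * (ln k.+1%:R - ln k%:R) - c * ln k.+1%:R) / k.+1%:R :> R).
  by ring.
by rewrite cE subrr mul0r.
Qed.

(** After rearrangement only two values [b <= v] remain: [b = 0] is the Dirac case, [b = k.+1%:R^-1]
    the uniform one, and in between the two-value inequality is strict. For [k = 1] the constant is
    [c = 1] and the sum vanishes identically, whence [2 <= k]. *)
Lemma psi_sum_ge0 (k : nat) c (s : seq R) : (2 <= k)%N ->
  c * ln k.+1%:R = k%:R * (ln k.+1%:R - ln k%:R) ->
  size s = k.+1 -> all (fun x => 0 <= x) s -> \sum_(x <- s) x = 1 ->
  0 <= \sum_(x <- s) psi c x /\
  (\sum_(x <- s) psi c x = 0 -> 1 \in s \/ all (pred1 k.+1%:R^-1) s).
Proof.
move=> k2 cE; case: s => [//|u s] [sk] s0 s1.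
have k2' : 2 <= k%:R :> R by rewrite (ler_nat _ 2).
have mE : k.+1%:R = k%:R + 1 :> R by rewrite natr1.
have lnm0 : 0 < ln (k.+1%:R : R) by apply: ln_gt0; rewrite mE; lra.
have c0 : 0 < c.
  rewrite -(pmulr_lgt0 _ lnm0) cE mulr_gt0 ?subr_gt0 ?ltr_ln ?posrE ?mE//; lra.
have [b [v [b0 bc bv [sE sle seq]]]] := psi_rearrange c0 s0 ltac:(by rewrite s1).
rewrite s1 sk in sE sle seq.
have lebv : b <= v.
  by case: bv => [->//|cv]; rewrite -(@ler_pM2r _ (1 + c)); lra.
have vE : v = 1 - k%:R * b by lra.
have [b00|bN0] := eqVneq b 0.
  have v1 : v = 1 by rewrite vE b00 mulr0 subr0.
  rewrite b00 v1 psi0 psi1 mulr0 addr0 in sle seq.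
  split=> // e; left; rewrite (perm_mem (seq _)) ?inE ?eqxx//.
have {bN0}b0 : 0 < b by rewrite lt0r bN0.
have [b1|b1] := ltP ((k%:R + 1) * b) 1.
  have := @psi_two_values_gt0 _ k c b k2 cE b0 b1; rewrite -vE => G0.
  by split=> [|e]; lra.
have bm : b = k.+1%:R^-1.
  have e : k.+1%:R * b = 1 by rewrite mE; lra.
  have m0 : k.+1%:R != 0 :> R by rewrite pnatr_eq0.
  by apply: (mulfI m0); rewrite e divff.
have vb : v = b.
  by apply/eqP; rewrite eq_le lebv andbT; lra.
have psib : psi c b = 0 by rewrite bm psi_inv_card// ltnW.
rewrite vb psib mulr0 addr0 in sle seq.
split=> // e; right; rewrite (perm_all _ (seq (esym e))).
by apply/allP => y; rewrite inE mem_nseq bm => /orP[//|/andP[]].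
Qed.

(** Dividing the coordinates by [Z] gives a point of the simplex, and [D] is [ln k.+1%:R * Z] times
    the sum of [psi c] over it, with the denominator of [c] cleared. *)
Lemma column_entropy (V : finType) (A : {set V}) (a : V -> R) (k : nat) (Z : R) :
  (2 <= k)%N -> #|A| = k.+1 -> (forall x, x \in A -> 0 <= a x) ->
  \sum_(x in A) a x = Z -> 0 < Z ->
  let D := ln k.+1%:R * \sum_(x in A) (Z - a x) * (ln Z - ln (Z - a x))
    - k%:R * (ln k.+1%:R - ln k%:R) * \sum_(x in A) a x * (ln Z - ln (a x)) in
  0 <= D /\ (D = 0 -> (exists2 x, x \in A & a x = Z) \/
                      (forall x, x \in A -> a x = Z / k.+1%:R)).
Proof.
move=> k2 cA a0 aZ Z0 D.
have lnm0 : 0 < ln (k.+1%:R : R) by apply: ln_gt0; rewrite ltr1n; lia.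
pose c : R := k%:R * (ln k.+1%:R - ln k%:R) / ln k.+1%:R.
have cE : c * ln k.+1%:R = k%:R * (ln k.+1%:R - ln k%:R).
  by rewrite divfK ?lt0r_neq0.
pose s := [seq a x / Z | x <- enum A].
have big F : \sum_(y <- s) F y = \sum_(x in A) F (a x / Z) :> R.
  by rewrite big_map big_enum.
have xlnx y : 0 <= y -> y / Z * ln (y / Z) = - (y * (ln Z - ln y)) / Z.
  rewrite le_eqVlt => /predU1P[<-|y0]; first by rewrite !mul0r oppr0 mul0r.
  by rewrite ln_div ?posrE//; ring.
have aleZ x : x \in A -> a x <= Z.
  move=> xA; rewrite -aZ (bigD1 x)//= lerDl sumr_ge0// => y /andP[yA _].
  exact: a0.
have DE : D = ln k.+1%:R * Z * \sum_(y <- s) psi c y.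
  rewrite /D -cE big.
  transitivity (ln k.+1%:R * (\sum_(x in A) (Z - a x) * (ln Z - ln (Z - a x))
     - c * \sum_(x in A) a x * (ln Z - ln (a x)))); first by ring.
  rewrite -[in RHS]mulrA; congr (_ * _).
  rewrite !mulr_sumr -sumrB; apply: eq_bigr => x xA.
  rewrite /psi xlnx ?a0//.
  have -> : 1 - a x / Z = (Z - a x) / Z by field; rewrite lt0r_neq0.
  rewrite xlnx ?subr_ge0 ?aleZ//; field.
  by rewrite lt0r_neq0.
have [| | |S0 Seq] := @psi_sum_ge0 k c s k2 cE.
- by rewrite size_map -cardE.
- by apply/allP => y /mapP[x]; rewrite mem_enum => xA ->; rewrite divr_ge0 ?a0 ?ltW.
- by rewrite big -mulr_suml aZ divff ?lt0r_neq0.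
have K0 : 0 < ln k.+1%:R * Z by rewrite mulr_gt0.
split; first by rewrite DE; apply: mulr_ge0 => //; apply: ltW.
rewrite DE => /eqP; rewrite mulf_eq0 gt_eqF//= => /eqP/Seq[/mapP[x]|/allP h].
  rewrite mem_enum => xA e; left; exists x => //.
  by rewrite -[LHS](divfK (lt0r_neq0 Z0)) -e mul1r.
right=> x xA; have /eqP e : a x / Z == k.+1%:R^-1.
  by apply: h; apply/mapP; exists x; rewrite ?mem_enum.
by rewrite -[LHS](divfK (lt0r_neq0 Z0)) e mulrC.
Qed.

End ColumnInequality.

(** * The two-step inequality on a class *)

Section LocalInequality.
Variables (R : realType) (V L J : finType) (e : V -> L -> J) (C : {set L}).
Variables (f : L -> R).
Hypothesis f_ge0 : forall t, 0 <= f t.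

(** In the application [L] is the set of labellings, [J] the set of labels, [e x t] the label at
    [x], and [C] a class of labellings agreeing off [A]; [f] is an unnormalized law on [C]. *)
Definition tot := \sum_(t in C) f t.
Definition mass x j := \sum_(t in C | e x t == j) f t.
Definition mass2 x y i j := \sum_(t in C | (e x t == i) && (e y t == j)) f t.

Lemma tot_ge0 : 0 <= tot. Proof. exact: sumr_ge0. Qed.
Lemma mass_ge0 x j : 0 <= mass x j. Proof. exact: sumr_ge0. Qed.

Lemma mass_le_tot x j : mass x j <= tot.
Proof.
rewrite /tot (bigID (fun t => e x t == j))/= lerDl.
exact: sumr_ge0.
Qed.

Lemma tot_sub_mass x j : tot - mass x j = \sum_(t in C | e x t != j) f t.
Proof.
by rewrite /tot (bigID (fun t => e x t == j))/= addrAC subrr add0r.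
Qed.

Lemma sum_mass x : \sum_j mass x j = tot.
Proof. by rewrite /tot (partition_big (e x) predT). Qed.

Lemma sum_by_value x (g : J -> R) :
  \sum_(t in C) f t * g (e x t) = \sum_j mass x j * g j.
Proof.
rewrite (partition_big (e x) predT)//=; apply: eq_bigr => j _.
by rewrite mulr_suml; apply: eq_bigr => t /andP[_ /eqP->].
Qed.

Lemma sum_by_values x y (g : J -> J -> R) :
  \sum_(t in C) f t * g (e x t) (e y t) =
  \sum_i \sum_j mass2 x y i j * g i j.
Proof.
rewrite (partition_big (e x) predT)//=; apply: eq_bigr => i _.
rewrite (partition_big (e y) predT)//=; apply: eq_bigr => j _.
rewrite mulr_suml; apply: eq_big => [t|t /andP[/andP[_ /eqP->] /eqP->]//].
by rewrite andbA.
Qed.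

(* Gibbs' inequality: given e y = j, the law of e x is compared to the law of
   e x conditioned on e x <> j. *)
Lemma gibbs_pair x y : (forall t, t \in C -> e x t != e y t) ->
  \sum_(t in C) f t * (ln (mass x (e x t)) - ln (mass2 x y (e x t) (e y t)))
  <= \sum_(t in C) f t * (ln (tot - mass x (e y t)) - ln (mass y (e y t))).
Proof.
move=> exy; rewrite -subr_le0 -sumrB.
(* For [i != j] this is the mass the pair of labels would have if, given [e y = j], the label at [x]
   followed its law conditioned on being different from [j]. *)
pose w i j := mass x i * mass y j / (tot - mass x j).
have f_mass z t : t \in C -> f t <= mass z (e z t).
  by move=> tC; rewrite /mass (bigD1 t) ?tC ?eqxx//= lerDl sumr_ge0.
apply: (@le_trans _ _
  (\sum_(t in C) (f t * (w (e x t) (e y t) / mass2 x y (e x t) (e y t)) - f t))).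
  apply: ler_sum => t tC.
  have := f_ge0 t; rewrite le_eqVlt => /predU1P[<-|ft]; first by rewrite !mul0r !subr0.
  have mx : 0 < mass x (e x t) by apply: lt_le_trans (f_mass x t tC).
  have my : 0 < mass y (e y t) by apply: lt_le_trans (f_mass y t tC).
  have m2 : 0 < mass2 x y (e x t) (e y t).
    apply: lt_le_trans ft _.
    by rewrite /mass2 (bigD1 t) ?tC ?eqxx//= lerDl sumr_ge0.
  have mc : 0 < tot - mass x (e y t).
    apply: lt_le_trans ft _.
    by rewrite tot_sub_mass (bigD1 t) ?tC ?exy//= lerDl sumr_ge0.
  set u := w _ _ / _.
  have u0 : 0 < u by rewrite !divr_gt0 ?mulr_gt0.
  have := ln_le_sub1 u0.
  rewrite /u /w !(ln_div, lnM) ?posrE ?divr_gt0 ?mulr_gt0// -/(w _ _) -/u => h.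
  rewrite -mulrBr -[X in _ <= _ - X]mulr1 -mulrBr ler_pM2l//.
  lra.
rewrite sumrB (sum_by_values x y (fun i j => w i j / mass2 x y i j)) subr_le0.
have w0 i j : 0 <= w i j.
  by rewrite divr_ge0 ?mulr_ge0 ?mass_ge0// subr_ge0 mass_le_tot.
(* The diagonal drops out because the labels at [x] and [y] differ; elsewhere a vanishing [mass2]
   contributes 0, which is at most [w i j]. *)
apply: (@le_trans _ _ (\sum_j \sum_(i | i != j) w i j)).
  rewrite exchange_big/=; apply: ler_sum => j _.
  rewrite [X in _ <= X]big_mkcond; apply: ler_sum => i _.
  have [->|ij] := eqVneq i j.
    rewrite /mass2 big_pred0 ?mul0r// => t.
    apply/negbTE/negP => /andP[tC /andP[/eqP ti /eqP tj]].
    by have := exy t tC; rewrite ti tj eqxx.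
  have [->|m0] := eqVneq (mass2 x y i j) 0; first by rewrite mul0r; exact: w0.
  by rewrite mulrC divfK.
rewrite -/tot -(sum_mass y); apply: ler_sum => j _.
have -> : \sum_(i | i != j) w i j =
    mass y j * ((tot - mass x j) / (tot - mass x j)).
  have sx : \sum_(i | i != j) mass x i = tot - mass x j.
    by rewrite -(sum_mass x) [in RHS](bigD1 j)//= addrAC subrr add0r.
  rewrite -[X in _ * (X * _)]sx [X in _ * X]mulr_suml mulr_sumr; apply: eq_bigr => i _.
  by rewrite /w (mulrC (mass x i)) mulrA.
(* If all the mass has label [j] at [x], the quotient is 0 by convention and the bound by [mass y j]
   still holds. *)
have [->|m0] := eqVneq (tot - mass x j) 0; first by rewrite mul0r mulr0 mass_ge0.
by rewrite divff// mulr1.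
Qed.

Variables (A : {set V}) (k : nat).
Hypothesis k2 : (2 <= k)%N.
Hypothesis cardA : #|A| = k.+1.
Hypothesis inj_e : forall t x y, t \in C -> x \in A -> y \in A ->
  x != y -> e x t != e y t.
Hypothesis columns : forall j,
  \sum_(x in A) mass x j = tot \/ forall x, x \in A -> mass x j = 0.

(** What Gibbs' inequality leaves of [local_gap], sorted by label: the first sum by the label at
    [y], the second by the label at [x]. *)
Definition column_gap j :=
  ln k.+1%:R * \sum_(x in A) \sum_(y in A :\ x)
      mass y j * (ln (mass y j) - ln (tot - mass x j))
  + k%:R * ln k%:R * \sum_(x in A) mass x j * (ln tot - ln (mass x j)).

Definition local_gap :=
  ln k.+1%:R * \sum_(x in A) \sum_(y in A :\ x) \sum_(t in C)
      f t * (ln (mass2 x y (e x t) (e y t)) - ln (mass x (e x t)))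
  + k%:R * ln k%:R * \sum_(x in A) \sum_(t in C)
      f t * (ln tot - ln (mass x (e x t))).

Lemma column_gap_le_local_gap : \sum_j column_gap j <= local_gap.
Proof.
rewrite /column_gap big_split/= -!mulr_sumr lerD//.
  rewrite ler_wpM2l ?ln_ge0 ?ler1n//.
  rewrite exchange_big/=; apply: ler_sum => x xA.
  rewrite exchange_big/=; apply: ler_sum => y; rewrite in_setD1 => /andP[yx yA].
  rewrite -(sum_by_value y (fun j => ln (mass y j) - ln (tot - mass x j))).
  rewrite -lerN2 -!sumrN.
  under eq_bigr => t _ do rewrite -mulrN opprB.
  under [X in _ <= X]eq_bigr => t _ do rewrite -mulrN opprB.
  by apply: gibbs_pair => t tC; apply: inj_e; rewrite 1?eq_sym.
rewrite exchange_big/= le_eqVlt; apply/orP; left; apply/eqP; congr (_ * _).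
by apply: eq_bigr => x _; rewrite -(sum_by_value x (fun j => ln tot - ln (mass x j))).
Qed.

(** Completing the sums over [A :\ x] to sums over [A] brings in the column total; the outcome is
    the [D] of [column_entropy]. *)
Lemma column_gapE j : \sum_(x in A) mass x j = tot ->
  column_gap j =
  ln k.+1%:R * \sum_(x in A) (tot - mass x j) * (ln tot - ln (tot - mass x j))
  - k%:R * (ln k.+1%:R - ln k%:R) *
    \sum_(x in A) mass x j * (ln tot - ln (mass x j)).
Proof.
move=> cj.
pose S1 := \sum_(x in A) mass x j * ln (mass x j).
pose S2 := \sum_(x in A) (tot - mass x j) * ln (tot - mass x j).
have offx x F : x \in A -> \sum_(y in A :\ x) F y = \sum_(y in A) F y - F x :> R.
  by move=> xA; rewrite [in RHS](big_setD1 x)//= addrAC subrr add0r.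
have sumA (c : R) : \sum_(x in A) c = (k%:R + 1) * c.
  by rewrite sumr_const cardA -[LHS]mulr_natl natr1.
have -> : \sum_(x in A) (tot - mass x j) * (ln tot - ln (tot - mass x j)) =
    k%:R * tot * ln tot - S2.
  under eq_bigr do rewrite mulrBr.
  by rewrite sumrB -mulr_suml sumrB sumA cj; congr (_ * _ - _); ring.
have -> : \sum_(x in A) mass x j * (ln tot - ln (mass x j)) = tot * ln tot - S1.
  under eq_bigr do rewrite mulrBr.
  by rewrite sumrB -mulr_suml cj.
have cg : \sum_(x in A) \sum_(y in A :\ x)
      mass y j * (ln (mass y j) - ln (tot - mass x j)) = k%:R * S1 - S2.
  transitivity (\sum_(x in A) (S1 - mass x j * ln (mass x j)
       - (tot - mass x j) * ln (tot - mass x j))).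
    apply: eq_bigr => x xA; under eq_bigr do rewrite mulrBr.
    by rewrite sumrB offx// -mulr_suml offx// cj.
  by rewrite !sumrB sumA -/S1 -/S2; ring.
rewrite /column_gap cg.
have -> : \sum_(x in A) mass x j * (ln tot - ln (mass x j)) = tot * ln tot - S1.
  under eq_bigr do rewrite mulrBr.
  by rewrite sumrB -mulr_suml cj.
ring.
Qed.

Lemma column_gap_ge0 j : 0 <= column_gap j.
Proof.
have zero : (forall x, x \in A -> mass x j = 0) -> 0 <= column_gap j.
  move=> m0; rewrite /column_gap big1 ?big1 ?mulr0 ?addr0// => x xA.
    by rewrite m0// mul0r.
  by rewrite big1// => y /setD1P[_ yA]; rewrite m0// mul0r.
have [cj|] := columns j; last exact: zero.
have := tot_ge0; rewrite le_eqVlt => /predU1P[/esym t0|t0].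
  by apply: zero => x _; apply/eqP; rewrite eq_le mass_ge0 -{1}t0 mass_le_tot.
rewrite column_gapE//.
exact: (column_entropy k2 cardA (fun x _ => mass_ge0 x j) cj t0).1.
Qed.

Lemma local_gap_ge0 : 0 <= local_gap.
Proof.
apply: le_trans column_gap_le_local_gap; apply: sumr_ge0 => j _.
exact: column_gap_ge0.
Qed.

Lemma local_gap_eq0 : local_gap = 0 -> 0 < tot ->
  forall j, \sum_(x in A) mass x j = tot ->
  (exists2 x, x \in A & mass x j = tot) \/
  (forall x, x \in A -> mass x j = tot / k.+1%:R).
Proof.
move=> g0 t0 j cj.
have s0 : \sum_j column_gap j = 0.
  have h := column_gap_le_local_gap; rewrite g0 in h.
  apply/eqP; rewrite eq_le h/=.
  by apply: sumr_ge0 => i _; exact: column_gap_ge0.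
have cj0 : column_gap j = 0.
  exact: (psumr_eq0P (fun i _ => column_gap_ge0 i) s0).
rewrite column_gapE// in cj0.
exact: (column_entropy k2 cardA (fun x _ => mass_ge0 x j) cj t0).2.
Qed.

End LocalInequality.

(** * Labellings and their conditional entropies *)

Section Labellings.
Variable V : finType.
Implicit Types (A : {set V}) (s t u : labelling V) (x y z : V).

Lemma val_labelling_inj s : injective (val s).
Proof. exact/injectiveP/(valP s). Qed.

Lemma val_labelling_bij s : bijective (val s).
Proof. by apply: inj_card_bij (@val_labelling_inj s) _; rewrite card_ord. Qed.

Lemma agree_offP A s t :
  reflect (forall z, z \notin A -> val t z = val s z) (agree_off A s t).
Proof.
apply: (iffP forallP) => h z; first by move=> zA; have /implyP/(_ zA)/eqP := h z.
by apply/implyP => zA; apply/eqP/h.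
Qed.

Lemma agree_off_refl A s : agree_off A s s.
Proof. exact/agree_offP. Qed.

Lemma agree_off_sym A s t : agree_off A s t = agree_off A t s.
Proof. by apply/agree_offP/agree_offP => h z zA; rewrite h. Qed.

Lemma agree_off_eql A s t : agree_off A s t -> agree_off A s =1 agree_off A t.
Proof.
move=> /agree_offP st u; apply/agree_offP/agree_offP => h z zA.
  by rewrite st ?h.
by rewrite h ?st.
Qed.

Lemma agree_off_setD1 A x s t : x \in A ->
  agree_off (A :\ x) s t = agree_off A s t && (val t x == val s x).
Proof.
move=> xA; apply/agree_offP/andP => [h|[/agree_offP h /eqP tx] z].
  split; last by apply/eqP/h; rewrite setD11.
  by apply/agree_offP => z zA; apply: h; rewrite in_setD1 (negbTE zA) andbF.
by rewrite in_setD1 negb_and negbK => /orP[/eqP->|/h].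
Qed.

Lemma injectiveb_comp_perm s (p : {perm V}) : injectiveb [ffun z => val s (p z)].
Proof.
by apply/injectiveP => y z; rewrite !ffunE => /val_labelling_inj/perm_inj.
Qed.

Definition permute_labelling s (p : {perm V}) : labelling V :=
  exist (fun h : {ffun V -> 'I_#|V|} => injectiveb h) _ (injectiveb_comp_perm s p).

(** Each labelling in the class of [s] is [s] precomposed with a unique permutation moving only
    points of [A]. *)
Lemma card_agree_off A s : #|[pred t | agree_off A s t]| = (#|A|)`!.
Proof.
rewrite -card_perm -(@card_in_image _ _ (permute_labelling s)); last first.
  move=> p q _ _ /(congr1 val)/ffunP e; apply/permP => z.
  by have := e z; rewrite !ffunE => /val_labelling_inj.
apply: eq_card => t; apply/idP/fintype.imageP => [|[p pA ->]]; rewrite inE.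
  move/agree_offP => st.
  have [g sg gs] := val_labelling_bij s.
  have ginj : injective (g \o val t).
    exact: inj_comp (can_inj gs) (@val_labelling_inj t).
  exists (perm ginj); last by apply/val_inj/ffunP => z; rewrite ffunE permE /= gs.
  by apply/fintype.subsetP => z; rewrite inE permE /=; apply: contraR => /st->; rewrite sg.
apply/agree_offP => z zA; rewrite ffunE.
by have := out_perm pA zA => ->.
Qed.

Lemma card_labelling : #|{: labelling V}| = (#|V|)`!.
Proof.
have /card_gt0P[s _] : (0 < #|{: labelling V}|)%N.
  apply/card_gt0P.
  have inj : injectiveb [ffun z : V => enum_rank z].
    by apply/injectiveP => y z; rewrite !ffunE => /enum_rank_inj.
  by exists (exist (fun h : {ffun V -> 'I_#|V|} => injectiveb h) _ inj).
have := card_agree_off [set: V] s; rewrite cardsT => <-; apply: eq_card => t.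
by rewrite !inE agree_off_setT.
Qed.

Definition label x s := val s x.

Definition agree_class A s := [set t | agree_off A s t].

Lemma agree_class_setT s : agree_class [set: V] s = [set: labelling V].
Proof. by apply/setP => t; rewrite !inE agree_off_setT. Qed.

Section Sums.
Variables (R : realType) (f : labelling V -> R).

(** This is S_A(s), and [class_log] is K(A), in the notation of the opening comment. *)
Definition class_sum A s := \sum_(t | agree_off A s t) f t.

Definition class_log A := \sum_s f s * ln (class_sum A s).

Lemma class_sum_eq A s t : agree_off A s t -> class_sum A s = class_sum A t.
Proof. by move=> st; apply: eq_bigl => u; apply: agree_off_eql. Qed.

(** With at most one free vertex its label is forced, so the classes are singletons; this yields t_0
    = t_1. *)
Lemma class_sum_small A s : (#|A| <= 1)%N -> class_sum A s = f s.
Proof.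
move=> A1; rewrite /class_sum (big_pred1 s)// => t.
have c1 : (#|[pred u | agree_off A s u]| <= 1)%N.
  by rewrite card_agree_off; case: #|A| A1 => [|[]].
apply/idP/eqP => [st|->]; last exact: agree_off_refl.
by apply: (card_le1_eqP c1); rewrite inE ?agree_off_refl.
Qed.

Lemma sum_over_classes (g : labelling V -> R) A :
  \sum_s \sum_(t | agree_off A s t) g t = (#|A|)`!%:R * \sum_t g t.
Proof.
rewrite (exchange_big_dep predT)//= mulr_sumr; apply: eq_bigr => t _.
rewrite sumr_const -[LHS]mulr_natl; congr (_%:R * _).
rewrite -(card_agree_off A t); apply: eq_card => s.
by rewrite !inE agree_off_sym.
Qed.

Lemma mean_cond_mean (g : labelling V -> R) A : mean (cond_mean A g) = mean g.
Proof.
rewrite /mean; congr (_ / _).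
under eq_bigr => s _ do rewrite /cond_mean card_agree_off.
by rewrite -mulr_suml sum_over_classes mulrAC divff ?mul1r.
Qed.

Hypothesis f_ge0 : forall s, 0 <= f s.

Lemma class_sum_ge A s : f s <= class_sum A s.
Proof.
by rewrite /class_sum (bigD1 s) ?agree_off_refl//= lerDl sumr_ge0.
Qed.

Lemma mean_cond_ent A : mean (cond_ent A f) =
  (\sum_s f s * ln (f s) - class_log A + ln ((#|A|)`!%:R) * \sum_s f s)
  / #|{: labelling V}|%:R.
Proof.
rewrite mean_cond_mean; congr (_ / _).
rewrite /class_log mulr_sumr -sumrB -big_split/=; apply: eq_bigr => s _.
have := f_ge0 s; rewrite le_eqVlt => /predU1P[<-|fs].
  by rewrite !mul0r mulr0 subrr addr0.
have S0 : 0 < class_sum A s by apply: lt_le_trans (class_sum_ge A s).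
have A0 : 0 < (#|A|)`!%:R :> R by rewrite ltr0n fact_gt0.
rewrite /cond_mean card_agree_off -/(class_sum A s).
by rewrite !ln_div ?posrE ?divr_gt0//; ring.
Qed.

Lemma class_sum_setT s : class_sum [set: V] s = \sum_t f t.
Proof. by apply: eq_bigl => t; rewrite agree_off_setT. Qed.

Lemma class_log_setT : class_log [set: V] = (\sum_s f s) * ln (\sum_s f s).
Proof. by rewrite mulr_suml; apply: eq_bigr => s _; rewrite class_sum_setT. Qed.

Lemma entE : ent f =
  (\sum_s f s * ln (f s) - class_log [set: V] + ln ((#|V|)`!%:R) * \sum_s f s)
  / #|{: labelling V}|%:R.
Proof.
have := mean_cond_ent [set: V]; rewrite cardsT => <-; rewrite /ent /cond_ent mean_cond_mean /mean.
by congr (_ / _); apply: eq_bigr => s _; rewrite cond_mean_setT.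
Qed.

(** A weighted second difference of K at a set of size [k.+1]: the factor [k%:R] matches the [k]
    choices of [y] for each [x], and the logarithms clear the denominators of the two slopes being
    compared. *)
Definition gap (k : nat) A :=
  ln k.+1%:R * \sum_(x in A) \sum_(y in A :\ x)
     (class_log (A :\ x :\ y) - class_log (A :\ x))
  + k%:R * ln k%:R * \sum_(x in A) (class_log A - class_log (A :\ x)).

Lemma tot_cls A s : tot (agree_class A s) f = class_sum A s.
Proof. by apply: eq_bigl => t; rewrite inE. Qed.

Lemma mass_cls A s t x : agree_off A s t -> x \in A ->
  mass label (agree_class A s) f x (val t x) = class_sum (A :\ x) t.
Proof.
move=> st xA; apply: eq_bigl => u.
by rewrite inE agree_off_setD1// (agree_off_eql st).
Qed.

Lemma mass2_cls A s t x y : agree_off A s t -> x \in A -> y \in A :\ x ->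
  mass2 label (agree_class A s) f x y (val t x) (val t y) = class_sum (A :\ x :\ y) t.
Proof.
move=> st xA yA; apply: eq_bigl => u.
by rewrite inE !agree_off_setD1// (agree_off_eql st) andbA.
Qed.

(** Throughout the class, the label of [s] at [y] occurs at exactly one vertex, and that vertex lies
    in [A]. *)
Lemma sum_mass_cls_in A s y : y \in A ->
  \sum_(x in A) mass label (agree_class A s) f x (val s y) = tot (agree_class A s) f.
Proof.
move=> yA.
rewrite /mass /tot (exchange_big_dep (mem (agree_class A s)))/=; last by move=> ? ? _ /andP[].
apply: eq_bigr => t; rewrite inE => /agree_offP st.
have [h th ht] := val_labelling_bij t.
rewrite (big_pred1 (h (val s y)))// => x.
rewrite inE; apply/andP/eqP => [[_ /andP[_ /eqP <-]]|->]; first by rewrite /label th.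
rewrite /label ht eqxx andbT; split; last exact/agree_offP.
apply/negPn/negP => hA; have := st _ hA; rewrite ht => /val_labelling_inj e.
by rewrite -e yA in hA.
Qed.

Lemma sum_mass_cls A s j :
  \sum_(x in A) mass label (agree_class A s) f x j = tot (agree_class A s) f \/
  (forall x, x \in A -> mass label (agree_class A s) f x j = 0).
Proof.
have [g sg gs] := val_labelling_bij s.
have [gA|gA] := boolP (g j \in A).
  by left; rewrite -[j in LHS]gs sum_mass_cls_in.
right=> x xA; rewrite /mass big_pred0// => t; rewrite inE.
apply/negbTE/negP => /andP[/agree_offP st /eqP tx].
have := st _ gA; rewrite gs -tx => /val_labelling_inj gx.
by move: gA; rewrite -tx gx xA.
Qed.

(** Summing over [s] counts every class once per member, that is |A|! times. *)
Lemma sum_local_gap k A :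
  \sum_s local_gap label (agree_class A s) f A k = (#|A|)`!%:R * gap k A.
Proof.
pose G t := ln k.+1%:R * \sum_(x in A) \sum_(y in A :\ x)
     f t * (ln (class_sum (A :\ x :\ y) t) - ln (class_sum (A :\ x) t))
  + k%:R * ln k%:R * \sum_(x in A)
     f t * (ln (class_sum A t) - ln (class_sum (A :\ x) t)).
transitivity (\sum_s \sum_(t | agree_off A s t) G t).
  apply: eq_bigr => s _; rewrite /local_gap /G big_split/= -!mulr_sumr.
  congr (_ * _ + _ * _); rewrite [in RHS]exchange_big/=; apply: eq_bigr => x xA.
    rewrite [in RHS]exchange_big/=; apply: eq_bigr => y yA.
    apply: eq_big => [t|t]; rewrite inE// => st.
    by rewrite mass2_cls// mass_cls.
  apply: eq_big => [t|t]; rewrite inE// => st.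
  by rewrite mass_cls// tot_cls (class_sum_eq st).
rewrite sum_over_classes; congr (_ * _).
rewrite /G big_split/= -!mulr_sumr; congr (_ * _ + _ * _).
  rewrite exchange_big; apply: eq_bigr => x _.
  rewrite exchange_big; apply: eq_bigr => y _.
  by rewrite /class_log -sumrB; apply: eq_bigr => t _; rewrite mulrBr.
rewrite exchange_big; apply: eq_bigr => x _.
by rewrite /class_log -sumrB; apply: eq_bigr => t _; rewrite mulrBr.
Qed.

Lemma local_gap_cls_ge0 k A s : (2 <= k)%N -> #|A| = k.+1 ->
  0 <= local_gap label (agree_class A s) f A k.
Proof.
move=> k2 cA; apply: local_gap_ge0 => // [t x y _ _ _|j].
  by apply: contra => /eqP/val_labelling_inj->.
exact: sum_mass_cls.
Qed.

Lemma gap_ge0 k A : (2 <= k)%N -> #|A| = k.+1 -> 0 <= gap k A.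
Proof.
move=> k2 cA.
have A0 : 0 < (#|A|)`!%:R :> R by rewrite ltr0n fact_gt0.
rewrite -(pmulr_rge0 _ A0) -sum_local_gap; apply: sumr_ge0 => s _.
exact: local_gap_cls_ge0.
Qed.

End Sums.
End Labellings.

(** * Averages over layers *)

Section LayerAverages.
Variables (R : realType) (V : finType).
Implicit Types (A B : {set V}) (F K : {set V} -> R).

(** Pairs of a set A and a point x of A are counted by B = A minus x, with x ranging over the
    complement of B. *)
Lemma sum_layer_setD1 K (m : nat) :
  \sum_(A : {set V} | #|A| == m.+1) \sum_(x in A) K (A :\ x) =
  (#|V| - m)%:R * \sum_(B : {set V} | #|B| == m) K B.
Proof.
rewrite (exchange_big_dep predT)//=.
transitivity (\sum_x \sum_(B : {set V} | (#|B| == m) && (x \notin B)) K B).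
  apply: eq_bigr => x _.
  rewrite (reindex_onto (fun B => x |: B) (fun A => A :\ x))/=; last first.
    by move=> A /andP[_ xA]; rewrite finset.setD1K.
  apply: eq_big => [B|B /andP[/andP[cB _] /eqP->]//].
  rewrite setU11 andbT cardsU1; apply/andP/andP.
    move=> [cB /eqP eB]; have xB : x \notin B by rewrite -eB setD11.
    by move: cB; rewrite xB add1n eqSS.
  by move=> [cB xB]; rewrite xB add1n eqSS cB finset.setU1K.
rewrite (exchange_big_dep (fun B => #|B| == m))/=; last by move=> x B _ /andP[].
rewrite mulr_sumr; apply: eq_bigr => B /eqP cB.
rewrite sumr_const -[LHS]mulr_natl; congr (_%:R * _).
rewrite -cB; transitivity #|~: B|; last by rewrite cardsCs finset.setCK.
by apply: eq_card => x; rewrite !inE eqxx.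
Qed.

Definition layer_avg K (m : nat) :=
  (\sum_(A : {set V} | #|A| == m) K A) / 'C(#|V|, m)%:R.

Lemma card_layer m : #|[pred A : {set V} | #|A| == m]| = 'C(#|V|, m).
Proof.
by rewrite -(card_draws V m); apply: eq_card => A; rewrite !inE.
Qed.

Lemma sum_layer_avg K m : (m <= #|V|)%N ->
  \sum_(A : {set V} | #|A| == m) K A = 'C(#|V|, m)%:R * layer_avg K m.
Proof.
by move=> mV; rewrite /layer_avg mulrC divfK// pnatr_eq0 -lt0n bin_gt0.
Qed.

Lemma layer_avg_cst K m c : (m <= #|V|)%N ->
  (forall A, #|A| = m -> K A = c) -> layer_avg K m = c.
Proof.
move=> mV Kc; rewrite /layer_avg.
under eq_bigr => A /eqP cA do rewrite Kc//.
rewrite sumr_const card_layer -[X in X / _]mulr_natl mulrAC divff ?mul1r//.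
by rewrite pnatr_eq0 -lt0n bin_gt0.
Qed.

(** Each of the four sums in [gap] is a double count; the identity (n - k) C(n, k) = (k + 1) C(n, k
    + 1), used at [k] and at [k.-1], brings out the common coefficient. *)
Lemma sum_layer_gap (f : labelling V -> R) (k : nat) : (0 < k < #|V|)%N ->
  let t := layer_avg (class_log f) in
  \sum_(A : {set V} | #|A| == k.+1) gap f k A =
  (k * k.+1 * 'C(#|V|, k.+1))%:R *
    (ln k%:R * (t k.+1 - t k) - ln k.+1%:R * (t k - t k.-1)).
Proof.
move=> /andP[k0 kV] t.
set K := class_log f; set n := #|V| in kV *.
pose T m := \sum_(A : {set V} | #|A| == m) K A.
have TE m : (m <= n)%N -> T m = 'C(n, m)%:R * t m by move=> mn; apply: sum_layer_avg.
have e1 : \sum_(A : {set V} | #|A| == k.+1) \sum_(x in A) K (A :\ x) =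
   (n - k)%:R * T k by apply: sum_layer_setD1.
have e2 : \sum_(A : {set V} | #|A| == k.+1) \sum_(x in A) K A = k.+1%:R * T k.+1.
  rewrite mulr_sumr; apply: eq_bigr => A /eqP cA.
  by rewrite sumr_const cA -[LHS]mulr_natl.
have e3 : \sum_(A : {set V} | #|A| == k.+1) \sum_(x in A) \sum_(y in A :\ x)
    K (A :\ x) = (n - k)%:R * (k%:R * T k).
  rewrite (sum_layer_setD1 (fun B => \sum_(y in B) K B)); congr (_ * _).
  rewrite mulr_sumr; apply: eq_bigr => A /eqP cA.
  by rewrite sumr_const cA -[LHS]mulr_natl.
have e4 : \sum_(A : {set V} | #|A| == k.+1) \sum_(x in A) \sum_(y in A :\ x)
    K (A :\ x :\ y) = (n - k)%:R * ((n - k.-1)%:R * T k.-1).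
  rewrite (sum_layer_setD1 (fun B => \sum_(y in B) K (B :\ y))); congr (_ * _).
  by rewrite -sum_layer_setD1 prednK.
have b1 : (n - k)%:R * 'C(n, k)%:R = k.+1%:R * 'C(n, k.+1)%:R :> R.
  by rewrite -!natrM mul_bin_left.
have b2 : (n - k.-1)%:R * 'C(n, k.-1)%:R = k%:R * 'C(n, k)%:R :> R.
  by rewrite -!natrM -mul_bin_left prednK.
transitivity (ln k.+1%:R * ((n - k)%:R * ((n - k.-1)%:R * T k.-1)
     - (n - k)%:R * (k%:R * T k))
   + k%:R * ln k%:R * (k.+1%:R * T k.+1 - (n - k)%:R * T k)).
  rewrite -e1 -e2 -e3 -e4 -!sumrB !mulr_sumr -big_split/=; apply: eq_bigr => A _.
  rewrite /gap -!sumrB; congr (_ * _ + _); apply: eq_bigr => x _.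
  by rewrite sumrB.
rewrite !TE; [|lia..].
rewrite (mulrA (n - k.-1)%:R) b2 !natrM.
transitivity ((n - k)%:R * 'C(n, k)%:R * k%:R *
  (ln k%:R * (- t k) - ln k.+1%:R * (t k - t k.-1)) +
  k%:R * k.+1%:R * 'C(n, k.+1)%:R * (ln k%:R * t k.+1)); first by ring.
by rewrite b1; ring.
Qed.

End LayerAverages.

(** * Sequences with nondecreasing logarithmic slopes *)

Section Sequences.
Variable R : realType.
Variables (n : nat) (t : nat -> R).
Hypothesis t10 : t 1%N = t 0%N.
Hypothesis slope : forall k, (2 <= k < n)%N ->
  ln k.+1%:R * (t k - t k.-1) <= ln k%:R * (t k.+1 - t k).

Lemma ln_nat_gt0 k : (2 <= k)%N -> 0 < ln (k%:R : R).
Proof. by move=> k2; apply: ln_gt0; rewrite ltr1n. Qed.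

Lemma ln_factS k : ln ((k.+1)`!%:R : R) = ln k.+1%:R + ln (k`!%:R).
Proof. by rewrite factS natrM lnM// posrE ltr0n ?fact_gt0. Qed.

Lemma ln_fact_gt0 k : (2 <= k)%N -> 0 < ln (k`!%:R : R).
Proof.
by move=> k2; apply: ln_nat_gt0; apply: leq_trans k2 (fact_geq k).
Qed.

(** Since ln l! is the sum of ln i for 2 <= i <= l, and t_1 = t_0, the ratio (t_l - t_0) / ln l! is
    a weighted average of the slopes (t_i - t_(i-1)) / ln i, hence at most the last of them. *)
Lemma last_slope_ge_avg l : (2 <= l <= n)%N ->
  (t l - t 0%N) * ln l%:R <= ln (l`!%:R) * (t l - t l.-1).
Proof.
elim: l => [//|l IH] /andP[l1 ln_]; have [l2|l2] := ltnP 1 l; last first.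
  have -> : l = 1%N by lia.
  by rewrite t10 /= mulrC.
have {}IH := IH ltac:(lia).
have S := slope (k := l) ltac:(lia).
have l0 := ln_nat_gt0 l2.
have m0 : 0 < ln (l.+1%:R : R) by apply: ln_nat_gt0; lia.
have f0 := ln_fact_gt0 l2.
rewrite ln_factS /=.
suff : ln l%:R * ((t l - t 0%N) * ln l.+1%:R) <=
       ln l%:R * (ln (l`!%:R) * (t l.+1 - t l)) by rewrite ler_pM2l//; lra.
apply: (@le_trans _ _ (ln (l`!%:R) * (ln l.+1%:R * (t l - t l.-1)))).
  have : (t l - t 0%N) * ln l%:R * ln l.+1%:R <=
         ln (l`!%:R) * (t l - t l.-1) * ln l.+1%:R by rewrite ler_pM2r.
  lra.
have : ln (l`!%:R) * (ln l.+1%:R * (t l - t l.-1)) <=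
  ln (l`!%:R) * (ln l%:R * (t l.+1 - t l)) by rewrite ler_pM2l.
lra.
Qed.

Definition ratio l := (t l - t 0%N) / ln (l`!%:R).

Lemma ratio_nondecreasing l m : (2 <= l <= m)%N -> (m <= n)%N -> ratio l <= ratio m.
Proof.
move=> /andP[l2]; elim: m => [|m IH] lm mn; first by lia.
move: lm; rewrite leq_eqVlt => /predU1P[->//|lm].
apply: le_trans (IH lm ltac:(lia)) _.
have m2 : (2 <= m)%N by lia.
have P := @last_slope_ge_avg m.+1 ltac:(lia).
have f0 := ln_fact_gt0 m2.
have f1 : 0 < ln ((m.+1)`!%:R : R) by apply: ln_fact_gt0; lia.
rewrite /ratio ler_pdivrMr// mulrAC ler_pdivlMr// ln_factS.
rewrite ln_factS /= in P; lra.
Qed.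

(** By monotonicity the ratios at [n.-1] and [n] agree, so the last slope equals [ratio n]. The
    slope before it is at least the ratio at [n.-1] and at most the last slope, hence equal to
    it. *)
Lemma ratio_eq l : (2 <= l < n)%N -> ratio l = ratio n ->
  [/\ t n - t 0%N = ratio n * ln (n`!%:R),
      t n - t n.-1 = ratio n * ln n%:R &
      ln n%:R * (t n.-1 - t n.-2) = ln n.-1%:R * (t n - t n.-1)].
Proof.
case: n slope last_slope_ge_avg ratio_nondecreasing => [|k] S P M; first by lia.
move=> /andP[l2 lk] lE; rewrite /= ltnS in lk *.
have k2 : (2 <= k)%N by lia.
have kE : ratio k = ratio k.+1.
  by apply: le_anti; rewrite M ?leqnn//= -?lE ?M//; lia.
have f0 := ln_fact_gt0 k2.
have f1 : 0 < ln ((k.+1)`!%:R : R) by apply: ln_fact_gt0; lia.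
have e1 : t k.+1 - t 0%N = ratio k.+1 * ln ((k.+1)`!%:R).
  by rewrite divfK ?lt0r_neq0.
have e0 : t k - t 0%N = ratio k.+1 * ln (k`!%:R).
  by rewrite -kE divfK ?lt0r_neq0.
have e2 : t k.+1 - t k = ratio k.+1 * ln k.+1%:R.
  rewrite ln_factS in e1; lra.
split=> //; apply: le_anti; rewrite S ?k2 ?ltnSn//= e2.
have := P k ltac:(lia); rewrite e0 mulrAC [X in X <= _]mulrC ler_pM2l// => h.
have l0 : 0 < ln (k.+1%:R : R) by apply: ln_nat_gt0; lia.
have : ln k.+1%:R * (ratio k.+1 * ln k%:R) <= ln k.+1%:R * (t k - t k.-1).
  by rewrite ler_pM2l.
lra.
Qed.

End Sequences.

(** * Extremal functions and the entropy constant *)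

Section Extremals.
Variables (R : realType) (V : finType) (f : labelling V -> R).
Hypothesis V2 : (2 <= #|V|)%N.
Hypothesis f_ge0 : forall s, 0 <= f s.

Let t := layer_avg (class_log f).
Let Z := \sum_s f s.
Let N : R := #|{: labelling V}|%:R.

Lemma card_labelling_gt0 : 0 < N.
Proof. by rewrite ltr0n card_labelling fact_gt0. Qed.

Lemma class_log_avg_small m : (m <= 1)%N -> t m = \sum_s f s * ln (f s).
Proof.
move=> m1; apply: layer_avg_cst => [|A cA]; first by lia.
by apply: eq_bigr => s _; rewrite class_sum_small// cA.
Qed.

Lemma class_log_avgT : t #|V| = class_log f [set: V].
Proof.
apply: layer_avg_cst => // A cA; congr class_log.
by apply/eqP; rewrite eqEcard finset.subsetT cardsT cA leqnn.
Qed.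

Lemma class_log_slope k : (2 <= k < #|V|)%N ->
  ln k.+1%:R * (t k - t k.-1) <= ln k%:R * (t k.+1 - t k).
Proof.
move=> k2; rewrite -subr_ge0.
have c0 : 0 < (k * k.+1 * 'C(#|V|, k.+1))%:R :> R.
  by rewrite ltr0n !muln_gt0 bin_gt0; lia.
rewrite -(pmulr_rge0 _ c0) -sum_layer_gap; last by lia.
by apply: sumr_ge0 => A /eqP cA; apply: gap_ge0 => //; lia.
Qed.

Let avg_ratio := ratio t.

Lemma avg_ratio_le l : (2 <= l <= #|V|)%N -> avg_ratio l <= avg_ratio #|V|.
Proof.
move=> l2; apply: (@ratio_nondecreasing _ #|V|) => //.
- by rewrite !class_log_avg_small.
- exact: class_log_slope.
Qed.

Lemma ent_avgE : ent f = (t 0%N - t #|V| + ln ((#|V|)`!%:R) * Z) / N.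
Proof. by rewrite entE// class_log_avg_small// class_log_avgT. Qed.

(** The terms in [Z] cancel. Both the inequality and its equality case are thereby read off the
    monotonicity of [avg_ratio]. *)
Lemma layer_ent_deficit l : (2 <= l <= #|V|)%N ->
  \sum_(A : {set V} | #|A| == l) mean (cond_ent A f) -
  'C(#|V|, l)%:R * ln (l`!%:R) / ln ((#|V|)`!%:R) * ent f =
  'C(#|V|, l)%:R / N * ln (l`!%:R) * (avg_ratio #|V| - avg_ratio l).
Proof.
move=> /andP[l2 lV].
have -> : \sum_(A : {set V} | #|A| == l) mean (cond_ent A f) =
    'C(#|V|, l)%:R * ((t 0%N - t l + ln (l`!%:R) * Z) / N).
  under eq_bigr => A /eqP cA do rewrite mean_cond_ent// cA.
  rewrite -mulr_suml mulrA; congr (_ / _).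
  rewrite big_split/= sumrB (sum_layer_avg (class_log f))// !sumr_const card_layer.
  by rewrite -[X in X - _ + _]mulr_natl -[X in _ + X]mulr_natl -/t
    (class_log_avg_small (leq0n 1)) /Z; ring.
rewrite ent_avgE /avg_ratio /ratio.
have f0 := ln_fact_gt0 R l2.
have f1 := ln_fact_gt0 R V2.
have N0 := card_labelling_gt0.
by field; rewrite !lt0r_neq0.
Qed.

(** The remainder [h s] in the tangent bound for the logarithm is nonnegative, zero only where
    [f s = M], and sums to [N * ent f]. *)
Lemma ent_eq0_constant : 0 < Z -> ent f = 0 -> forall s, f s = Z / N.
Proof.
move=> Z0 e0; have N0 := card_labelling_gt0.
set M := Z / N; have M0 : 0 < M by rewrite divr_gt0.
pose h s := f s * ln (f s / M) - (f s - M).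
have hpos s : f s != M -> 0 < h s.
  move=> fM; have := f_ge0 s; rewrite /h le_eqVlt => /predU1P[<-|fs].
    by rewrite mul0r !sub0r opprK.
  have u1 : M / f s != 1.
    by apply: contra fM => /eqP e; rewrite -[M](divfK (lt0r_neq0 fs)) e mul1r.
  have := ln_lt_sub1 (divr_gt0 M0 fs) u1.
  rewrite -[f s / M]invf_div lnV ?posrE ?divr_gt0//.
  set u := M / f s => hu.
  have uE : f s * u = M by rewrite mulrC divfK ?lt0r_neq0.
  have := ltr_pM2l fs (ln u) (u - 1); rewrite hu mulrBr uE; lra.
have h0 s : 0 <= h s.
  have [e|/hpos/ltW//] := eqVneq (f s) M.
  by rewrite /h e divff ?lt0r_neq0// ln1 mulr0 !subrr.
have hs : \sum_s h s = 0.
  rewrite sumrB sumrB sumr_const -/Z -[X in _ - (_ - X)]mulr_natl -/N.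
  have -> : N * M = Z by rewrite mulrC divfK ?lt0r_neq0.
  rewrite subrr subr0; apply/eqP.
  have : ent f * N = 0 by rewrite e0 mul0r.
  by rewrite /ent /mean -/Z -/N -/M divfK ?lt0r_neq0// => ->.
move=> s; apply/eqP/negPn/negP => /hpos; rewrite lt_neqAle => /andP[/eqP[]].
by have := psumr_eq0P (fun s _ => h0 s) hs => /(_ s isT) ->.
Qed.

Let vertex_mass := mass (@label V) [set: labelling V] f.

Lemma tot_setT : tot [set: labelling V] f = Z.
Proof. by apply: eq_bigl => s; rewrite inE. Qed.

(** Equal ratios force equality of the last two slopes, so [gap] vanishes at the full vertex set,
    the only set in its layer; its local gap then vanishes too, and every column is extremal. *)
Lemma avg_ratio_eq_column l : (2 <= l < #|V|)%N ->
  avg_ratio l = avg_ratio #|V| -> 0 < Z ->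
  avg_ratio #|V| * ln #|V|%:R = t #|V| - t #|V|.-1 /\
  forall j, (exists x, vertex_mass x j = Z) \/
            (forall x, vertex_mass x j = Z / #|V|%:R).
Proof.
move=> l2 lE Z0.
have [|e1 e2 e3] := @ratio_eq _ #|V| t _ class_log_slope l l2 lE.
  by rewrite !class_log_avg_small.
split=> // j.
case Vk : #|V| => [|k]; first by lia.
have k2 : (2 <= k)%N by lia.
have gap0 : gap f k [set: V] = 0.
  have := @sum_layer_gap _ _ f k ltac:(lia).
  rewrite (big_pred1 [set: V]) => [->|A]; last first.
    by rewrite /= eqEcard finset.subsetT/= cardsT -Vk eqn_leq max_card.
  by rewrite -/t; move: e3; rewrite Vk /= => ->; rewrite subrr mulr0.
have [s _] : exists s : labelling V, true.
  by have := card_labelling_gt0; rewrite ltr0n => /card_gt0P[s]; exists s.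
have cT : #|[set: V]| = k.+1 by rewrite cardsT.
have lg u : local_gap (@label V)
    (agree_class [set: V] u) f [set: V] k = 0.
  have h := sum_local_gap f k [set: V].
  rewrite gap0 mulr0 in h.
  have /(_ u isT) := psumr_eq0P (fun u _ => local_gap_cls_ge0 f_ge0 u k2 cT) h.
  by [].
have {lg} := lg s; rewrite agree_class_setT => lg.
have colZ i : \sum_(x in [set: V]) vertex_mass x i = Z.
  have [g _ gs] := val_labelling_bij s.
  by rewrite /vertex_mass -tot_setT -(agree_class_setT s) -[i]gs sum_mass_cls_in ?inE.
have := local_gap_eq0 f_ge0 k2 cT _ _ lg.
rewrite tot_setT => /(_ _ _ Z0 j (colZ j))[||[x _ xj]|h].
- by move=> v x y _ _ _; apply: contra => /eqP/val_labelling_inj->.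
- by move=> i; left; exact: colZ.
- by left; exists x.
- by right=> x; apply: h; rewrite inE.
Qed.

(* A permutation matrix forces [f] to be concentrated on that permutation. *)
Lemma dirac_of_columns : 0 < Z ->
  (forall j, exists x, vertex_mass x j = Z) -> dirac_multiple f.
Proof.
move=> Z0 col.
have supp s x j : vertex_mass x j = Z -> f s != 0 -> val s x = j.
  move=> xj fs; apply/eqP/negPn/negP => sx.
  have := tot_sub_mass (@label V) [set: labelling V] f x j.
  rewrite tot_setT -/(vertex_mass x j) xj subrr => /esym e.
  have f0 : f s = 0 by apply: (psumr_eq0P _ e) => //; rewrite inE sx.
  by rewrite f0 eqxx in fs.
have [s0 fs0] : exists s0, f s0 != 0.
  apply/existsP; apply: contraTT (Z0) => /existsPn h.
  by rewrite -leNgt /Z big1// => s _; apply/eqP/negPn/h.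
exists (f s0), s0 => s.
have [->|ss0] := eqVneq s s0; first by rewrite /Defs.dirac eqxx mulr1.
rewrite /Defs.dirac (negbTE ss0) mulr0; apply/eqP; apply: contraNT ss0 => fs.
apply/eqP/val_inj/ffunP => y.
have [x xj] := col (val s y).
have /val_labelling_inj <- := supp s x _ xj fs.
by rewrite (supp s0 x _ xj fs0) (supp s x _ xj fs).
Qed.

(** Uniform columns give t_(n-1) = Z (ln Z - ln n), while t_n = Z ln Z; so the last slope, and with
    it the ratio, is [Z], which makes the entropy vanish. *)
Lemma ent_eq0_of_uniform_columns : 0 < Z ->
  avg_ratio #|V| * ln #|V|%:R = t #|V| - t #|V|.-1 ->
  (forall x j, vertex_mass x j = Z / #|V|%:R) -> ent f = 0.
Proof.
move=> Z0 rE unif.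
have n0 : 0 < #|V|%:R :> R by rewrite ltr0n; lia.
have KE x : class_log f ([set: V] :\ x) = Z * (ln Z - ln #|V|%:R).
  rewrite /class_log -/Z [in RHS]mulr_suml; apply: eq_bigr => s _.
  congr (_ * _); rewrite -ln_div ?posrE// -(unif x (val s x)).
  congr ln; rewrite -(mass_cls f (agree_off_refl [set: V] s)) ?inE//.
  by apply: eq_bigl => u; rewrite !inE agree_off_setT.
have tE : t #|V|.-1 = Z * (ln Z - ln #|V|%:R).
  have := @sum_layer_setD1 R V (class_log f) #|V|.-1.
  have -> : (#|V| - #|V|.-1 = 1)%N by lia.
  rewrite prednK; last by lia.
  rewrite (big_pred1 [set: V]) => [|A]; last first.
    by rewrite /= eqEcard finset.subsetT/= cardsT eqn_leq max_card.
  rewrite mul1r sum_layer_avg ?leq_pred// -/t.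
  have -> : 'C(#|V|, #|V|.-1) = #|V|.
    by rewrite -subn1 bin_sub ?bin1; lia.
  under eq_bigr => x _ do rewrite KE.
  rewrite sumr_const cardsT -[LHS]mulr_natl => e.
  by apply: (mulfI (lt0r_neq0 n0)); rewrite -e.
have ln0 := ln_nat_gt0 R V2.
have rZ : avg_ratio #|V| = Z.
  apply: (mulIf (lt0r_neq0 ln0)); rewrite rE tE class_log_avgT class_log_setT -/Z.
  by ring.
have e : t #|V| - t 0%N = Z * ln ((#|V|)`!%:R).
  by rewrite -rZ /avg_ratio /ratio divfK ?lt0r_neq0 ?ln_fact_gt0.
rewrite ent_avgE; have -> : t 0%N - t #|V| + ln ((#|V|)`!%:R) * Z = 0 by lra.
by rewrite mul0r.
Qed.

Lemma extremal_dirac l : (2 <= l < #|V|)%N ->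
  avg_ratio l = avg_ratio #|V| -> ~ (exists c, forall s, f s = c) ->
  dirac_multiple f.
Proof.
move=> l2 lE nc.
have Z0 : 0 < Z.
  rewrite lt0r sumr_ge0// andbT; apply/eqP => e; apply: nc; exists 0 => s.
  exact: (psumr_eq0P (fun s _ => f_ge0 s) e).
have [rE col] := avg_ratio_eq_column l2 lE Z0.
have n0 : 0 < #|V|%:R :> R by rewrite ltr0n; lia.
have [|] := pselect (forall j, exists x, vertex_mass x j = Z).
  exact: dirac_of_columns.
move=> /existsNP[j0 nj0]; exfalso; apply: nc; exists (Z / N).
apply: ent_eq0_constant => //; apply: ent_eq0_of_uniform_columns => //.
have unif0 x : vertex_mass x j0 = Z / #|V|%:R by have [|->] := col j0.
(* A Dirac column cannot coexist with a uniform one: row [y] would carry [Z] at [j] and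
   [Z / #|V|%:R] at [j0], exceeding its total [Z]. *)
move=> x j; have [[y yj]|//] := col j; exfalso.
have jj0 : j0 != j by apply/eqP => e; apply: nj0; exists y; rewrite e.
have := sum_mass (@label V) [set: labelling V] f y.
rewrite tot_setT (bigD1 j)//= (bigD1 j0)//= -!/(vertex_mass _ _) yj unif0.
have : 0 < Z / #|V|%:R by rewrite divr_gt0.
have : 0 <= \sum_(i | (i != j) && (i != j0)) vertex_mass y i.
  by apply: sumr_ge0 => i _; exact: mass_ge0.
lra.
Qed.

End Extremals.

(** * Dirac masses *)

Section DiracMasses.
Variables (R : realType) (V : finType) (f : labelling V -> R).
Hypothesis f_dirac : dirac_multiple f.

(** The class sum at [s0] is the same for every [A]; all layer averages then agree and the ratios
    vanish. *)
Lemma dirac_class_log : exists c, forall A, class_log f A = c.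
Proof.
have [c [s0 fE]] := f_dirac; exists (c * ln c) => A.
have fs s : s != s0 -> f s = 0 by move=> ss0; rewrite fE /Defs.dirac (negbTE ss0) mulr0.
have fs0 : f s0 = c by rewrite fE /Defs.dirac eqxx mulr1.
rewrite /class_log (bigD1 s0)//= big1 ?addr0 => [|s /fs->]; last by rewrite mul0r.
rewrite fs0 /class_sum (bigD1 s0) ?agree_off_refl//= fs0 big1 ?addr0// => s.
by move=> /andP[_ /fs].
Qed.

Lemma dirac_ratio l : (l <= #|V|)%N -> ratio (layer_avg (class_log f)) l = 0.
Proof.
have [c cE] := dirac_class_log; move=> lV.
by rewrite /ratio !(layer_avg_cst (c := c))// subrr mul0r.
Qed.

End DiracMasses.

(** * The entropy constant and its extremal functions *)

Section EntropyConstant.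
Variables (R : realType) (V : finType) (w : nat -> R) (alpha : {set V} -> R).
Hypothesis V2 : (2 <= #|V|)%N.
Hypothesis w_ge0 : forall l, (2 <= l <= #|V|)%N -> 0 <= w l.
Hypothesis alphaE : forall A,
  alpha A = \sum_(2 <= l < #|V|.+1) w l * layer R l A.

Let kappa := \sum_(2 <= l < #|V|.+1)
  w l * ('C(#|V|, l)%:R * ln (l`!%:R) / ln ((#|V|)`!%:R)).

Lemma total_ent_layers (f : labelling V -> R) : total_ent alpha f =
  \sum_(2 <= l < #|V|.+1)
    w l * \sum_(A : {set V} | #|A| == l) mean (cond_ent A f).
Proof.
rewrite /total_ent; under eq_bigr => A _ do rewrite alphaE mulr_suml.
rewrite exchange_big/=; apply: eq_bigr => l _.
rewrite mulr_sumr [RHS]big_mkcond; apply: eq_bigr => A _.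
by rewrite /layer; case: ifP => _; rewrite ?mulr1 ?mulr0 ?mul0r.
Qed.

Definition layer_deficit (f : labelling V -> R) l :=
  w l * ('C(#|V|, l)%:R / #|{: labelling V}|%:R * ln (l`!%:R) *
   (ratio (layer_avg (class_log f)) #|V| - ratio (layer_avg (class_log f)) l)).

Lemma total_ent_deficit (f : labelling V -> R) : (forall s, 0 <= f s) ->
  total_ent alpha f - kappa * ent f = \sum_(2 <= l < #|V|.+1) layer_deficit f l.
Proof.
move=> f0; rewrite total_ent_layers /kappa [X in _ - X]mulr_suml -sumrB.
apply: eq_big_nat => l; rewrite ltnS => l2.
by rewrite /layer_deficit -layer_ent_deficit// mulrBr !mulrA.
Qed.

Lemma layer_deficit_ge0 (f : labelling V -> R) l : (forall s, 0 <= f s) ->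
  (2 <= l <= #|V|)%N -> 0 <= layer_deficit f l.
Proof.
move=> f0 l2; apply: mulr_ge0; first exact: w_ge0.
apply: mulr_ge0; last by rewrite subr_ge0; apply: avg_ratio_le.
by rewrite mulr_ge0 ?divr_ge0// ln_ge0// ler1n fact_gt0.
Qed.

Lemma kappa_admissible : admissible alpha kappa.
Proof.
split; last first.
  move=> f f0; rewrite -subr_ge0 total_ent_deficit// big_nat_cond.
  by apply: sumr_ge0 => l; rewrite andbT ltnS => /layer_deficit_ge0; apply.
rewrite /kappa big_nat_cond; apply: sumr_ge0 => l; rewrite andbT ltnS => l2.
by rewrite mulr_ge0 ?w_ge0// divr_ge0 ?mulr_ge0// ln_ge0// ler1n fact_gt0.
Qed.

Lemma kappa_dirac (f : labelling V -> R) : (forall s, 0 <= f s) ->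
  dirac_multiple f -> kappa * ent f = total_ent alpha f.
Proof.
move=> f0 fd; apply/esym/eqP; rewrite -subr_eq0 total_ent_deficit//.
apply/eqP; rewrite big_nat_cond; apply: big1 => l; rewrite andbT ltnS => /andP[_ lV].
by rewrite /layer_deficit !dirac_ratio// subrr !mulr0.
Qed.

(* Unqualified, [dirac] is the Dirac measure of the analysis library. *)
Lemma ent_dirac_gt0 (s0 : labelling V) : 0 < ent (Defs.dirac R s0).
Proof.
have f0 s : 0 <= Defs.dirac R s0 s by exact: ler0n.
have fd : dirac_multiple (Defs.dirac R s0) by exists 1, s0 => s; rewrite mul1r.
rewrite ent_avgE//; apply: divr_gt0; last exact: card_labelling_gt0.
have [c cE] := dirac_class_log fd.
rewrite !(layer_avg_cst (c := c))// subrr add0r mulr_gt0 ?ln_fact_gt0//.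
rewrite (bigD1 s0)//= /Defs.dirac eqxx big1 ?addr0// => s ss0.
by rewrite (negbTE ss0).
Qed.

(** The test function is a Dirac mass, which has positive entropy and gives equality for [kappa]. *)
Lemma admissible_le_kappa k : admissible alpha k -> k <= kappa.
Proof.
move=> [_ adm].
have [s0 _] : exists s0 : labelling V, true.
  by have := card_labelling_gt0 R V; rewrite ltr0n => /card_gt0P[s]; exists s.
rewrite -(ler_pM2r (ent_dirac_gt0 s0)) kappa_dirac; first exact: adm.
  by move=> s; exact: ler0n.
by exists 1, s0 => s; rewrite mul1r.
Qed.

Lemma entropy_constantE : entropy_constant alpha = kappa.
Proof.
apply/eqP; rewrite eq_le; apply/andP; split.
  apply: ge_sup; first by exists kappa; exact: kappa_admissible.
  by move=> k /=; exact: admissible_le_kappa.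
apply: ub_le_sup; last exact: kappa_admissible.
by exists kappa => k /=; exact: admissible_le_kappa.
Qed.

(** The deficits are nonnegative and sum to 0, so the one at [l] vanishes; its coefficient is
    positive, which equates the two ratios. The deficit at [#|V|] itself is zero for every [f],
    hence the condition [l < #|V|]. *)
Lemma equality_dirac l (f : labelling V -> R) : (2 <= l < #|V|)%N -> 0 < w l ->
  (forall s, 0 <= f s) -> ~ (exists c, forall s, f s = c) ->
  kappa * ent f = total_ent alpha f -> dirac_multiple f.
Proof.
move=> /andP[l2 lV] wl f0 nc e.
apply: (@extremal_dirac _ _ _ V2 f0 l) => //; first by rewrite l2.
have /eqP : \sum_(2 <= i < #|V|.+1) layer_deficit f i = 0.
  by rewrite -total_ent_deficit// e subrr.
rewrite big_nat_cond psumr_eq0 => [|i]; last first.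
  by rewrite andbT ltnS; exact: layer_deficit_ge0.
move=> /allP /(_ l); rewrite mem_index_iota l2 ltnS ltnW// => /(_ isT)/=.
have c0 : 0 < 'C(#|V|, l)%:R / #|{: labelling V}|%:R * ln (l`!%:R) :> R.
  rewrite mulr_gt0 ?ln_fact_gt0// divr_gt0 ?card_labelling_gt0//.
  by rewrite ltr0n bin_gt0 ltnW.
rewrite /layer_deficit mulf_eq0 (gt_eqF wl)/= mulf_eq0 (gt_eqF c0)/= subr_eq0.
by move=> /eqP.
Qed.

End EntropyConstant.

(** The uniqueness claim leaves out two degenerate cases: if no [l < n] has positive weight, both
    sides equal [w n * ent f] for every [f], and a constant [f] always gives 0 on both sides. *)
Theorem theorem1p9 (R : realType) (V : finType) (n : nat)
    (hn : (2 <= n)%N) (hV : #|V| = n)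
    (w : nat -> R) (hw : forall l : nat, (2 <= l <= n)%N -> 0 <= w l)
    (alpha : {set V} -> R)
    (halpha : forall A : {set V},
       alpha A = \sum_(2 <= l < n.+1) w l * layer R l A) :
  [/\ entropy_constant alpha =
        \sum_(2 <= l < n.+1) w l * ('C(n, l)%:R * ln (l`!%:R) / ln (n`!%:R)),
      admissible alpha (entropy_constant alpha)
        /\ (forall k : R, admissible alpha k -> k <= entropy_constant alpha),
      forall f : labelling V -> R, (forall s, 0 <= f s) -> dirac_multiple f ->
        entropy_constant alpha * ent f = total_ent alpha f
    & (exists l : nat, (2 <= l < n)%N /\ 0 < w l) ->
      forall f : labelling V -> R, (forall s, 0 <= f s) ->
        ~ (exists c : R, forall s, f s = c) ->
        (entropy_constant alpha * ent f = total_ent alpha f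
           <-> dirac_multiple f)].
Proof.
subst n; rewrite (entropy_constantE hn hw halpha); split=> //.
- split; first exact: kappa_admissible.
  by move=> k; apply: admissible_le_kappa.
- by move=> f f0 fd; apply: kappa_dirac.
- move=> [l [l2 wl]] f f0 nc; split.
    exact: (equality_dirac hn hw halpha l2 wl f0 nc).
  by move=> fd; apply: kappa_dirac.
Qed.
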